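(* Let $n\ge1$ and let $\mu\in\mathbb{C}^n$ be generic. Every simple cuspidal $AW_\mu$-module is isomorphic (as an $AW_\mu$-module) to a module of tensor fields $T(\alpha,\beta)$ for some $\alpha,\beta\in\mathbb{C}$.
   Context: A vector $\mu\in\mathbb{C}^n$ is generic if $\mu\cdot r\neq 0$ for all $r\in\mathbb{Z}^n\setminus\{0\}$. Put $\Gamma_\mu=\{\mu\cdot r\mid r\in\mathbb{Z}^n\}\subset\mathbb{C}$. Let $A=\mathbb{C}[t_1^{\pm1},\dots,t_n^{\pm1}]$, $t^r=t_1^{r_1}\cdots t_n^{r_n}$, $d_\mu=\sum_{i=1}^n\mu_it_i\frac{\partial}{\partial t_i}$. The solenoidal Lie algebra is $W_\mu=Ad_\mu\subset\mathrm{Der}(A)$; with $e_{\mu\cdot r}=t^rd_\mu$ it has basis $\{e_k\mid k\in\Gamma_\mu\}$ and bracket $[e_k,e_m]=(m-k)e_{k+m}$. An $AW_\mu$-module is a vector space $M$ that is a module for both the Lie algebra $W_\mu$ and the commutative unital algebra $A$, with $x(fv)=(xf)v+f(xv)$ for all $f\in A$, $x\in W_\mu$, $v\in M$. A $W_\mu$-module is a weight module if $M=\bigoplus_{\lambda\in\mathbb{C}}M_\lambda$, $M_\lambda=\{v\in M\mid d_\mu v=\lambda v\}$; a weight module is cuspidal if the dimensions of its weight spaces are uniformly bounded by some constant. An $AW_\mu$-module is cuspidal if it is so as a $W_\mu$-module; simple means having no proper nonzero $AW_\mu$-submodules. For $\alpha,\beta\in\mathbb{C}$, $T(\alpha,\beta)$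 has basis $\{v_s\mid s\in\beta+\Gamma_\mu\}$, with $W_\mu$-action $e_kv_s=(s+\alpha k)v_{s+k}$ and $A$-action $t^rv_s=v_{s+\mu\cdot r}$ ($k\in\Gamma_\mu$, $r\in\mathbb{Z}^n$, $s\in\beta+\Gamma_\mu$). *)

(* Defs.v *)
From HB Require Import structures.
From mathcomp Require Import all_boot all_order all_algebra.
From mathcomp Require Import ring.
From mathcomp Require Export boolp classical_sets functions.
From mathcomp Require Export finmap cardinality fsbigop reals complex.

Set Implicit Arguments.
Unset Strict Implicit.
Unset Printing Implicit Defensive.

Import GRing.Theory.
Local Open Scope classical_set_scope.
Local Open Scope ring_scope.

Section FreeModule.
Variables (K : fieldType) (J : choiceType).

Definition finitely_supported : {pred J -> K} :=
  fun f => `[< finite_set [set j | f j != 0] >].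

Lemma finitely_supportedP (f : J -> K) :
  reflect (exists D : {fset J}, forall j, j \notin D -> f j = 0)
          (f \in finitely_supported).
Proof.
apply: (iffP (asboolP _)) => [/finite_fsetP[D defD]|[D Df0]].
  exists D => j; apply: contraNeq => fj0.
  by have: [set j | f j != 0] j by []; rewrite defD.
apply: (@sub_finite_set _ _ [set` D]); last exact: finite_fset.
by move=> j /=; apply: contraNT => /Df0->.
Qed.

(* The vector space with basis J, as finitely supported functions on J. *)
Record free_module := FreeModule {
  fcoef :> J -> K;
  _ : fcoef \in finitely_supported
}.

HB.instance Definition _ := [isSub for fcoef].
HB.instance Definition _ := [Choice of free_module by <:].

Lemma fcoefP (f g : free_module) : (forall j, f j = g j) -> f = g.
Proof. by move=> fg; apply/val_inj/funext. Qed.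

Lemma fcoef_fin (f : free_module) :
  exists D : {fset J}, forall j, j \notin D -> f j = 0.
Proof. exact/finitely_supportedP/valP. Qed.

Fact fzero_subproof : (fun=> 0) \in finitely_supported.
Proof. by apply/finitely_supportedP; exists fset0. Qed.

Fact fopp_subproof (f : free_module) : (fun j => - f j) \in finitely_supported.
Proof.
have [D Df] := fcoef_fin f; apply/finitely_supportedP.
by exists D => j /Df->; rewrite oppr0.
Qed.

Fact fadd_subproof (f g : free_module) :
  (fun j => f j + g j) \in finitely_supported.
Proof.
have [D Df] := fcoef_fin f; have [E Eg] := fcoef_fin g.
apply/finitely_supportedP; exists (D `|` E)%fset => j.
by rewrite inE negb_or => /andP[/Df-> /Eg->]; rewrite addr0.
Qed.

Fact fscale_subproof (c : K) (f : free_module) :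
  (fun j => c * f j) \in finitely_supported.
Proof.
have [D Df] := fcoef_fin f; apply/finitely_supportedP.
by exists D => j /Df->; rewrite mulr0.
Qed.

Definition fzero := FreeModule fzero_subproof.
Definition fopp f := FreeModule (fopp_subproof f).
Definition fadd f g := FreeModule (fadd_subproof f g).
Definition fscale c f := FreeModule (fscale_subproof c f).

Fact faddA : associative fadd.
Proof. by move=> f g h; apply: fcoefP => j; apply: addrA. Qed.

Fact faddC : commutative fadd.
Proof. by move=> f g; apply: fcoefP => j; apply: addrC. Qed.

Fact fadd0 : left_id fzero fadd.
Proof. by move=> f; apply: fcoefP => j; apply: add0r. Qed.

Fact faddN : left_inverse fzero fopp fadd.
Proof. by move=> f; apply: fcoefP => j; apply: addNr. Qed.

HB.instance Definition _ :=
  GRing.isZmodule.Build free_module faddA faddC fadd0 faddN.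

Fact fscaleA c1 c2 f : fscale c1 (fscale c2 f) = fscale (c1 * c2) f.
Proof. by apply: fcoefP => j; apply: mulrA. Qed.

Fact fscale1 : left_id 1 fscale.
Proof. by move=> f; apply: fcoefP => j; apply: mul1r. Qed.

Fact fscaleDr : right_distributive fscale +%R.
Proof. by move=> c f g; apply: fcoefP => j; apply: mulrDr. Qed.

Fact fscaleDl f : {morph fscale^~ f : c1 c2 / c1 + c2}.
Proof. by move=> c1 c2; apply: fcoefP => j; apply: mulrDl. Qed.

HB.instance Definition _ := GRing.Zmodule_isLmodule.Build K free_module
  fscaleA fscale1 fscaleDr fscaleDl.

Implicit Types (f g : free_module).

Lemma fcoefD f g j : (f + g) j = f j + g j.
Proof. by []. Qed.

Lemma fcoefZ c f j : (c *: f) j = c * f j.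
Proof. by []. Qed.

Fact fbasis_subproof (j : J) :
  (fun i => (i == j)%:R) \in finitely_supported.
Proof.
apply/finitely_supportedP; exists [fset j]%fset => i.
by rewrite inE => /negPf->.
Qed.

Definition fbasis (j : J) : free_module := FreeModule (fbasis_subproof j).

Lemma fbasisE j i : fbasis j i = (i == j)%:R.
Proof. by []. Qed.

End FreeModule.

(* Linear extension of a map given on the basis vectors. *)
Section LinearExtension.
Variables (K : fieldType) (J : choiceType) (V : lmodType K).
Implicit Types (g : free_module K J) (h : J -> V).

Definition fext h g : V := \sum_(j \in [set: J]) g j *: h j.

Lemma fextw h g (D : {fset J}) :
  (forall j, j \notin D -> g j = 0) -> fext h g = \sum_(j <- D) g j *: h j.
Proof. by move=> D0; apply: fsbigTE => j /D0->; rewrite scale0r. Qed.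

Fact fext_linr h (c : K) (f g : free_module K J) :
  fext h (c *: f + g) = c *: fext h f + fext h g.
Proof.
have [D Df] := fcoef_fin f; have [E Eg] := fcoef_fin g.
have{}Df j : j \notin (D `|` E)%fset -> f j = 0.
  by rewrite inE negb_or => /andP[/Df].
have{}Eg j : j \notin (D `|` E)%fset -> g j = 0.
  by rewrite inE negb_or => /andP[_ /Eg].
rewrite (fextw _ Df) (fextw _ Eg) (@fextw _ _ (D `|` E)%fset); last first.
  by move=> j Dj; rewrite fcoefD fcoefZ Df // Eg // mulr0 addr0.
rewrite scaler_sumr -big_split /=; apply: eq_bigr => j _.
by rewrite scalerDl scalerA.
Qed.

HB.instance Definition _ h :=
  GRing.isLinear.Build K (free_module K J) V *:%R (fext h) (fext_linr h).

Lemma fextU h j : fext h (fbasis K j) = h j.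
Proof.
rewrite (@fextw _ _ [fset j]%fset); last first.
  by move=> i; rewrite inE fbasisE => /negPf->.
by rewrite big_seq_fset1 fbasisE eqxx scale1r.
Qed.

Lemma fext_linl c h1 h2 g :
  fext (fun j => c *: h1 j + h2 j) g = c *: fext h1 g + fext h2 g.
Proof.
have [D Dg] := fcoef_fin g; rewrite !(fextw _ Dg) scaler_sumr -big_split.
by apply: eq_bigr => j _ /=; rewrite scalerDr !scalerA mulrC.
Qed.

Lemma eq_fext h1 h2 g : h1 =1 h2 -> fext h1 g = fext h2 g.
Proof. by move=> eqh; apply: eq_fsbigr => j _; rewrite eqh. Qed.
End LinearExtension.

Section BilinearExtension.
Variables (K : fieldType) (I J : choiceType) (V : lmodType K) (h : I -> J -> V).
Implicit Types (f : free_module K I) (g : free_module K J).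

Definition fext2 f g : V := fext (fun i => fext (h i) g) f.

Lemma fext2_linl (c : K) f1 f2 g :
  fext2 (c *: f1 + f2) g = c *: fext2 f1 g + fext2 f2 g.
Proof. exact: fext_linr. Qed.

Lemma fext2_linr f (c : K) g1 g2 :
  fext2 f (c *: g1 + g2) = c *: fext2 f g1 + fext2 f g2.
Proof.
rewrite /fext2 -fext_linl; apply: eq_fext => i; exact: fext_linr.
Qed.

Lemma fext20l g : fext2 0 g = 0.
Proof. exact: (linear0 (fext _)). Qed.

Lemma fext20r f : fext2 f 0 = 0.
Proof.
by have := fext2_linr f (-1) 0 0; rewrite scaler0 addr0 scaleN1r addNr.
Qed.

Lemma fext2U i j : fext2 (fbasis K i) (fbasis K j) = h i j.
Proof. by rewrite /fext2 !fextU. Qed.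
End BilinearExtension.

Lemma fext_basis (K : fieldType) (J : choiceType) (g : free_module K J) :
  fext (@fbasis K J) g = g.
Proof.
have [D Dg] := fcoef_fin g; rewrite (fextw _ Dg); apply: fcoefP => i.
transitivity (\sum_(j <- D) g j * (i == j)%:R).
  by elim/big_rec2: _ => // j x y _ IH; rewrite fcoefD fcoefZ IH.
have [iD|/[dup] iD /Dg->] := boolP (i \in D).
  rewrite (big_fsetD1 i) //= eqxx mulr1 big1_seq ?addr0 // => j /andP[_].
  by rewrite !inE eq_sym => /andP[/negPf-> _]; rewrite mulr0.
rewrite big1_seq // => j /andP[_ jD].
by case: eqP iD => [->|_ _]; rewrite ?jD ?mulr0.
Qed.

Lemma free_module_ind (K : fieldType) (J : choiceType)
    (P : free_module K J -> Prop) :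
    (forall j, P (fbasis K j)) ->
    P 0 -> (forall c f g, P f -> P g -> P (c *: f + g)) ->
  forall f, P f.
Proof.
move=> PU P0 PD f; have [D Df] := fcoef_fin f.
rewrite -[f]fext_basis (fextw _ Df).
by elim/big_rec: _ => // j g _ Pg; apply: PD.
Qed.

(* The Laurent polynomial ring K[t_1^{+-1}, .., t_n^{+-1}], whose basis
   consists of the monomials t^r, r in Z^n.  The monoid algebras of monalg.v do
   not cover it: they require a monoid of exponents without nontrivial
   invertible elements. *)
Definition laurent (K : fieldType) (n : nat) := free_module K 'rV[int]_n.

Section Laurent.
Variables (K : fieldType) (n : nat).
Local Notation A := (laurent K n).
Implicit Types (f g h : A) (r s : 'rV[int]_n).

HB.instance Definition _ := GRing.Lmodule.on A.

Definition monom r : A := fbasis K r.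

Lemma laurent_ind (P : A -> Prop) :
    (forall r, P (monom r)) ->
    P 0 -> (forall c f g, P f -> P g -> P (c *: f + g)) ->
  forall f, P f.
Proof. exact: free_module_ind. Qed.

Definition laurent_mul : A -> A -> A := fext2 (fun r s => monom (r + s)).

Fact laurent_mulU r s : laurent_mul (monom r) (monom s) = monom (r + s).
Proof. exact: fext2U. Qed.

Fact laurent_mulDl c f1 f2 g :
  laurent_mul (c *: f1 + f2) g = c *: laurent_mul f1 g + laurent_mul f2 g.
Proof. exact: fext2_linl. Qed.

Fact laurent_mulDr c f g1 g2 :
  laurent_mul f (c *: g1 + g2) = c *: laurent_mul f g1 + laurent_mul f g2.
Proof. exact: fext2_linr. Qed.

Fact laurent_mul0l g : laurent_mul 0 g = 0.
Proof. exact: fext20l. Qed.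

Fact laurent_mul0r f : laurent_mul f 0 = 0.
Proof. exact: fext20r. Qed.

Fact laurent_mulC : commutative laurent_mul.
Proof.
elim/laurent_ind => [r||c f1 f2 IH1 IH2] g;
  [|by rewrite laurent_mul0l laurent_mul0r
   |by rewrite laurent_mulDr laurent_mulDl IH1 IH2].
elim/laurent_ind: g => [s||c g1 g2 IH1 IH2];
  [|by rewrite laurent_mul0l laurent_mul0r
   |by rewrite laurent_mulDr laurent_mulDl IH1 IH2].
by rewrite !laurent_mulU; congr monom; apply: addrC.
Qed.

Fact laurent_mulA : associative laurent_mul.
Proof.
elim/laurent_ind => [r||c f1 f2 IH1 IH2] g h;
  [|by rewrite !laurent_mul0l|by rewrite !laurent_mulDl IH1 IH2].
elim/laurent_ind: g => [s||c g1 g2 IH1 IH2];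
  [|by rewrite laurent_mul0r !laurent_mul0l laurent_mul0r
   |by rewrite laurent_mulDr !laurent_mulDl laurent_mulDr IH1 IH2].
elim/laurent_ind: h => [u||c h1 h2 IH1 IH2];
  [|by rewrite !laurent_mul0r|by rewrite !laurent_mulDr IH1 IH2].
rewrite !laurent_mulU; congr monom; exact: addrA.
Qed.

Fact laurent_mul1 : left_id (monom 0) laurent_mul.
Proof.
elim/laurent_ind => [s||c g1 g2 IH1 IH2].
- rewrite laurent_mulU; congr monom; exact: add0r.
- exact: laurent_mul0r.
- by rewrite laurent_mulDr IH1 IH2.
Qed.

Fact laurent_mul_addl : left_distributive laurent_mul +%R.
Proof. by move=> f g h; rewrite -[f]scale1r laurent_mulDl !scale1r. Qed.

Fact laurent_oner_neq0 : monom 0 != 0.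
Proof.
apply/eqP => /(congr1 (fun f : A => f 0)) /eqP.
by rewrite fbasisE eqxx oner_eq0.
Qed.

HB.instance Definition _ := GRing.Zmodule_isComNzRing.Build A
  laurent_mulA laurent_mulC laurent_mul1 laurent_mul_addl laurent_oner_neq0.

Fact laurent_scalerAl (c : K) f g : c *: (f * g) = (c *: f) * g.
Proof.
by have := laurent_mulDl c f 0 g; rewrite laurent_mul0l !addr0 => /esym.
Qed.

HB.instance Definition _ := GRing.Lmodule_isLalgebra.Build K A laurent_scalerAl.
HB.instance Definition _ := GRing.Lalgebra_isComAlgebra.Build K A.

Lemma monomD r s : monom (r + s) = monom r * monom s.
Proof. by rewrite [RHS]laurent_mulU. Qed.

Definition tvar (i : 'I_n) : A := monom (delta_mx 0 i).

Definition partial (i : 'I_n) : A -> A :=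
  fext (fun r => (r 0 i)%:~R *: monom (r - delta_mx 0 i)).

Definition solenoidal_d (mu : 'rV[K]_n) (f : A) : A :=
  \sum_i mu 0 i *: (tvar i * partial i f).

Definition derivation (D : A -> A) : Prop :=
  linear D /\ forall f g, D (f * g) = D f * g + f * D g.

Definition pairing (mu : 'rV[K]_n) (r : 'rV[int]_n) : K :=
  \sum_i mu 0 i * (r 0 i)%:~R.

Definition generic (mu : 'rV[K]_n) : Prop :=
  forall r : 'rV[int]_n, r != 0 -> pairing mu r != 0.

Definition Gamma (mu : 'rV[K]_n) : set K :=
  [set k | exists r : 'rV[int]_n, k = pairing mu r]%classic.

Lemma pairing0 mu : pairing mu 0 = 0.
Proof. by rewrite /pairing big1 // => i _; rewrite mxE mulr0. Qed.

Lemma pairingD mu r s : pairing mu (r + s) = pairing mu r + pairing mu s.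
Proof.
rewrite /pairing -big_split; apply: eq_bigr => i _.
by rewrite mxE intrD mulrDr.
Qed.

Fact solenoidal_d_is_linear mu : linear (solenoidal_d mu).
Proof.
move=> c f g; rewrite /solenoidal_d scaler_sumr -big_split /=.
apply: eq_bigr => i _.
by rewrite /partial linearP mulrDr scalerDr -scalerAr !scalerA mulrC.
Qed.

HB.instance Definition _ mu :=
  GRing.isLinear.Build K A A *:%R (solenoidal_d mu) (solenoidal_d_is_linear mu).

Lemma solenoidal_dE mu r : solenoidal_d mu (monom r) = pairing mu r *: monom r.
Proof.
rewrite /solenoidal_d /pairing scaler_suml; apply: eq_bigr => i _.
rewrite /partial fextU -scalerAr -monomD scalerA.
by rewrite addrC subrK.
Qed.

Lemma solenoidal_dM mu f g :
  solenoidal_d mu (f * g) = solenoidal_d mu f * g + f * solenoidal_d mu g.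
Proof.
elim/laurent_ind: f g => [r||c f1 f2 IH1 IH2] g; last first.
- rewrite mulrDl -scalerAl !solenoidal_d_is_linear IH1 IH2.
  by rewrite !mulrDl -!scalerAl scalerDr addrACA.
- by rewrite mul0r !linear0 !mul0r addr0.
elim/laurent_ind: g => [s||c g1 g2 IH1 IH2]; last first.
- rewrite mulrDr -scalerAr !solenoidal_d_is_linear IH1 IH2.
  by rewrite !mulrDr -!scalerAr scalerDr addrACA.
- by rewrite mulr0 !linear0 !mulr0 addr0.
rewrite -monomD !solenoidal_dE pairingD scalerDl monomD.
by rewrite -scalerAl -scalerAr.
Qed.

End Laurent.

Section Solenoidal.
Variables (K : fieldType) (n : nat) (mu : 'rV[K]_n).
Local Notation A := (laurent K n).
Local Notation d := (solenoidal_d mu).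
Implicit Types (f g : A).

Definition in_solenoidal : {pred A -> A} :=
  fun D => `[< exists f, D = (fun g => f * d g) >].

Fact in_solenoidal_submod_closed : submod_closed in_solenoidal.
Proof.
split; first by apply/asboolP; exists 0; apply/funext => g; rewrite mul0r.
move=> c D E /asboolP[f ->] /asboolP[g ->]; apply/asboolP.
exists (c *: f + g); apply/funext => h; by rewrite mulrDl -scalerAl.
Qed.

HB.instance Definition _ := GRing.isSubmodClosed.Build K (A -> A) in_solenoidal
  in_solenoidal_submod_closed.

(* W_mu = A d_mu, as a subspace of the derivations of A (see [sol_der]). *)
Record solenoidal := Solenoidal {
  sol_fun :> A -> A;
  _ : sol_fun \in in_solenoidal
}.

HB.instance Definition _ := [isSub for sol_fun].
HB.instance Definition _ := [Choice of solenoidal by <:].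
HB.instance Definition _ := [SubChoice_isSubLmodule of solenoidal by <:].

Implicit Types (x y : solenoidal).

Fact sol_of_subproof f : (fun g => f * d g) \in in_solenoidal.
Proof. by apply/asboolP; exists f. Qed.

Definition sol_of f : solenoidal := Solenoidal (sol_of_subproof f).

Definition sol_d : solenoidal := sol_of 1.

(* The basis vector e_k of W_mu for k = mu . r. *)
Definition sol_e (r : 'rV[int]_n) : solenoidal := sol_of (monom K r).

Lemma solP x y : (forall g, x g = y g) -> x = y.
Proof. by move=> xy; apply/val_inj/funext. Qed.

Lemma sol_of_lin c f g : sol_of (c *: f + g) = c *: sol_of f + sol_of g.
Proof.
by apply: solP => h; rewrite -[LHS]/((c *: f + g) * d h) mulrDl -scalerAl.
Qed.

Lemma sol_ofP x : exists f, x = sol_of f.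
Proof.
by have /asboolP[f xf] := valP x; exists f; apply/val_inj.
Qed.

Lemma sol_der x : derivation x.
Proof.
have [f ->] := sol_ofP x; split=> [c g h|g h]; rewrite /sol_of /=.
  by rewrite solenoidal_d_is_linear mulrDr -scalerAr.
by rewrite solenoidal_dM mulrDr mulrA mulrCA.
Qed.

Lemma sol_ofM f g :
  (fun h => sol_of f (sol_of g h) - sol_of g (sol_of f h)) =
  sol_of (f * d g - g * d f).
Proof.
apply/funext => h /=; rewrite !solenoidal_dM !mulrDr !mulrDl mulNr !mulrA.
by rewrite opprD addrACA [g * f]mulrC subrr addr0.
Qed.

Fact sol_bracket_subproof x y :
  (fun g => x (y g) - y (x g)) \in in_solenoidal.
Proof.
have [f ->] := sol_ofP x; have [g ->] := sol_ofP y.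
by rewrite sol_ofM; apply: valP.
Qed.

Definition sol_bracket x y : solenoidal := Solenoidal (sol_bracket_subproof x y).

Lemma sol_bracket_of f g :
  sol_bracket (sol_of f) (sol_of g) = sol_of (f * d g - g * d f).
Proof. by apply: solP => h; apply: (congr1 (@^~ h) (sol_ofM f g)). Qed.

Lemma sol_bracket_e r s :
  sol_bracket (sol_e r) (sol_e s) =
  (pairing mu s - pairing mu r) *: sol_e (r + s).
Proof.
rewrite sol_bracket_of !solenoidal_dE -!scalerAr -!monomD (addrC s) -scalerBl.
by have := sol_of_lin (pairing mu s - pairing mu r) (monom K (r + s)) 0;
  rewrite addr0 => ->; apply: solP => h; rewrite -[LHS]/(_ + 0 * d h) mul0r addr0.
Qed.

End Solenoidal.

Section AWModule.
Variables (K : fieldType) (n : nat) (mu : 'rV[K]_n).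
Local Notation A := (laurent K n).
Local Notation W := (solenoidal mu).

Record AWmodule := AWModule {
  AWcarrier :> lmodType K;
  actA : A -> AWcarrier -> AWcarrier;
  actW : W -> AWcarrier -> AWcarrier;
  actA_linear : forall a, linear (actA a);
  actA_linearl : forall v, linear (actA^~ v);
  actA1 : forall v, actA 1 v = v;
  actAM : forall a b v, actA (a * b) v = actA a (actA b v);
  actW_linear : forall x, linear (actW x);
  actW_linearl : forall v, linear (actW^~ v);
  actW_bracket : forall x y v,
    actW (sol_bracket x y) v = actW x (actW y v) - actW y (actW x v);
  actWA : forall x a v, actW x (actA a v) = actA (x a) v + actA a (actW x v)
}.

Definition AWsubmodule (M : AWmodule) (S : set M) : Prop :=
  [/\ S 0,
      forall (c : K) u v, S u -> S v -> S (c *: u + v),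
      forall a v, S v -> S (actA a v)
    & forall x v, S v -> S (actW x v)].

Definition AWsimple (M : AWmodule) : Prop :=
  [set: M] <> [set 0] /\
  forall S : set M, AWsubmodule S -> S = [set 0] \/ S = [set: M].

Definition AWiso (M N : AWmodule) : Prop :=
  exists phi : {linear M -> N},
    [/\ bijective phi,
        forall a v, phi (actA a v) = actA a (phi v)
      & forall x v, phi (actW x v) = actW x (phi v)].

Definition weight_space (M : AWmodule) (lambda : K) : set M :=
  [set v | actW (sol_d mu) v = lambda *: v].

Definition weight_module (M : AWmodule) : Prop :=
  (forall v : M, exists (s : seq K) (u : K -> M),
     (forall lambda, weight_space lambda (u lambda)) /\
     v = \sum_(lambda <- s) u lambda) /\
  (forall (s : seq K) (u : K -> M), uniq s ->
     (forall lambda, weight_space lambda (u lambda)) ->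
     \sum_(lambda <- s) u lambda = 0 ->
     forall lambda, lambda \in s -> u lambda = 0).

(* The subspace S has dimension m. *)
Definition has_dim (V : lmodType K) (S : set V) (m : nat) : Prop :=
  exists b : 'I_m -> V,
    [/\ forall i, S (b i),
        forall c : 'I_m -> K, \sum_i c i *: b i = 0 -> forall i, c i = 0
      & forall v, S v -> exists c : 'I_m -> K, v = \sum_i c i *: b i].

Definition cuspidal (M : AWmodule) : Prop :=
  weight_module M /\
  exists N : nat, forall lambda : K,
    exists2 m : nat, (m <= N)%N & has_dim (@weight_space M lambda) m.

End AWModule.

Section TensorFields.
Variables (K : fieldType) (n : nat) (mu : 'rV[K]_n).
Hypotheses (n_gt0 : (0 < n)%N) (mu_generic : generic mu).
Variables (alpha beta : K).
Local Notation A := (laurent K n).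
Local Notation W := (solenoidal mu).

Fact pairing_delta (i : 'I_n) : pairing mu (delta_mx 0 i) = mu 0 i.
Proof.
rewrite /pairing (bigD1 i) //= mxE !eqxx mulr1 big1 ?addr0 // => j ji.
by rewrite mxE (negPf ji) andbF mulr0.
Qed.

(* Injectivity of f |-> f d_mu. *)
Lemma sol_of_inj : injective (@sol_of K n mu).
Proof.
pose i := Ordinal n_gt0.
have mui : pairing mu (delta_mx 0 i) != 0.
  apply: mu_generic; apply/eqP => /matrixP/(_ 0 i).
  by rewrite !mxE !eqxx.
move=> f g /(congr1 (fun x : W => x (monom K (delta_mx 0 i)))) /=.
rewrite !solenoidal_dE -!scalerAr => /(scalerI mui).
move=> /(congr1 (fun h => h * monom K (- delta_mx 0 i))).
by rewrite -!mulrA -!monomD subrr !mulr1.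
Qed.

(* The coefficient f of f d_mu. *)
Definition sol_coef (x : W) : A := xget 0 [set f | x = sol_of mu f].

Lemma sol_ofK : cancel (@sol_of K n mu) sol_coef.
Proof.
move=> f; rewrite /sol_coef; case: xgetP => [g _ /sol_of_inj-> //|].
by move=> /(_ f) [].
Qed.

Lemma sol_coefK : cancel sol_coef (@sol_of K n mu).
Proof. by move=> x; have [f ->] := sol_ofP x; rewrite sol_ofK. Qed.

Lemma sol_coef_lin c x y :
  sol_coef (c *: x + y) = c *: sol_coef x + sol_coef y.
Proof. by apply: sol_of_inj; rewrite sol_of_lin !sol_coefK. Qed.

Definition tsupport : set K := [set beta + k | k in Gamma mu].

Fact tshift_subproof (r : 'rV[int]_n) (s : tsupport) :
  val s + pairing mu r \in tsupport.
Proof.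
have /set_mem[_ [q ->] <-] := valP s; apply/mem_set.
exists (pairing mu (q + r)); first by exists (q + r).
by rewrite pairingD addrA.
Qed.

Definition tshift r (s : tsupport) : tsupport :=
  exist (fun x => x \in tsupport) _ (tshift_subproof r s).

Definition tbasis (s : tsupport) : free_module K tsupport := fbasis K s.

Definition T_actA : A -> free_module K tsupport -> free_module K tsupport :=
  fext2 (fun r s => tbasis (tshift r s)).

Definition T_act_e (r : 'rV[int]_n) (s : tsupport) : free_module K tsupport :=
  (val s + alpha * pairing mu r) *: tbasis (tshift r s).

Definition T_actW (x : W) : free_module K tsupport -> free_module K tsupport :=
  fext2 T_act_e (sol_coef x).

Lemma tshift0 s : tshift 0 s = s.
Proof. by apply: val_inj; rewrite /= pairing0 addr0. Qed.

Lemma tshiftD r q s : tshift (r + q) s = tshift r (tshift q s).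
Proof. by apply: val_inj; rewrite /= pairingD addrAC addrA. Qed.

Lemma T_actA_monom r s : T_actA (monom K r) (tbasis s) = tbasis (tshift r s).
Proof. exact: fext2U. Qed.

Lemma T_actW_e r s :
  T_actW (sol_e mu r) (tbasis s) =
  (val s + alpha * pairing mu r) *: tbasis (tshift r s).
Proof. by rewrite /T_actW sol_ofK; apply: fext2U. Qed.

Fact T_actA_linear a : linear (T_actA a).
Proof. by move=> c u v; apply: fext2_linr. Qed.

Fact T_actA_linearl v : linear (T_actA^~ v).
Proof. by move=> c a b; apply: fext2_linl. Qed.

Fact T_actW_linear x : linear (T_actW x).
Proof. by move=> c u v; apply: fext2_linr. Qed.

Fact T_actW_linearl v : linear (T_actW^~ v).
Proof. by move=> c x y; rewrite /T_actW sol_coef_lin fext2_linl. Qed.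

Fact T_actA1 v : T_actA 1 v = v.
Proof.
elim/free_module_ind: v => [s||c u v IHu IHv].
- by rewrite (T_actA_monom 0 s) tshift0.
- exact: fext20r.
- by rewrite T_actA_linear IHu IHv.
Qed.

Fact T_actA0l v : T_actA 0 v = 0. Proof. exact: fext20l. Qed.
Fact T_actA0r a : T_actA a 0 = 0. Proof. exact: fext20r. Qed.
Fact T_actW0r x : T_actW x 0 = 0. Proof. exact: fext20r. Qed.

Definition T_simp := (T_actA0l, T_actA0r, T_actW0r).

Fact T_actAM a b v : T_actA (a * b) v = T_actA a (T_actA b v).
Proof.
elim/free_module_ind: v => [s||c u v IHu IHv];
  [|by rewrite !T_simp|by rewrite !T_actA_linear IHu IHv].
elim/laurent_ind: a => [r||c a1 a2 IH1 IH2];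
  [|by rewrite mul0r !T_simp
   |by rewrite mulrDl -scalerAl !T_actA_linearl IH1 IH2].
elim/laurent_ind: b => [q||c b1 b2 IH1 IH2];
  [|by rewrite mulr0 !T_simp
   |by rewrite mulrDr -scalerAr !T_actA_linearl T_actA_linear IH1 IH2].
by rewrite -monomD -/(tbasis s) !T_actA_monom tshiftD.
Qed.

Local Notation d := (solenoidal_d mu).
Local Notation Tw := (fext2 T_act_e).

Fact T_actW_of f v : T_actW (sol_of mu f) v = Tw f v.
Proof. by rewrite /T_actW sol_ofK. Qed.

Fact Tw_bracket f g v :
  Tw (f * d g - g * d f) v = Tw f (Tw g v) - Tw g (Tw f v).
Proof.
have TwB a b u : Tw (a - b) u = Tw a u - Tw b u.
  by rewrite [a - b]addrC -[- b]scaleN1r fext2_linl scaleN1r addrC.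
have linB c (a1 a2 b1 b2 : free_module K tsupport) :
    c *: a1 + a2 - (c *: b1 + b2) = c *: (a1 - b1) + (a2 - b2).
  by rewrite opprD addrACA scalerBr.
rewrite TwB; elim/free_module_ind: v => [s||c u v IHu IHv]; last first.
- rewrite !fext2_linr opprD addrACA -scalerBr.
  by rewrite [in RHS]opprD [in RHS]addrACA -scalerBr IHu IHv.
- by rewrite !fext20r.
elim/laurent_ind: f => [r||c f1 f2 IH1 IH2]; last first.
- rewrite solenoidal_d_is_linear mulrDl mulrDr -scalerAl -scalerAr.
  by rewrite !fext2_linl fext2_linr !linB IH1 IH2.
- by rewrite mul0r !linear0 mulr0 !(fext20l, fext20r).
elim/laurent_ind: g => [q||c g1 g2 IH1 IH2]; last first.
- rewrite solenoidal_d_is_linear mulrDl mulrDr -scalerAl -scalerAr.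
  by rewrite !fext2_linl fext2_linr !linB IH1 IH2.
- by rewrite mul0r !linear0 mulr0 !(fext20l, fext20r).
have TwE p t : Tw (monom K p) (fbasis K t) = T_act_e p t by apply: fext2U.
have TwZ a c u : Tw a (c *: u) = c *: Tw a u.
  by rewrite -[c *: u]addr0 fext2_linr fext20r addr0.
have TwZl a c u : Tw (c *: a) u = c *: Tw a u.
  by rewrite -[c *: a]addr0 fext2_linl fext20l addr0.
rewrite !solenoidal_dE -!scalerAr -!monomD (addrC q r) !TwZl !TwE.
rewrite /T_act_e !TwZ !TwE /T_act_e -!tshiftD (addrC q r) !scalerA.
rewrite -!scalerBl; congr (_ *: _) => /=; rewrite pairingD.
by ring.
Qed.

Fact T_actW_bracket x y v :
  T_actW (sol_bracket x y) v = T_actW x (T_actW y v) - T_actW y (T_actW x v).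
Proof.
have [f ->] := sol_ofP x; have [g ->] := sol_ofP y.
by rewrite sol_bracket_of !T_actW_of Tw_bracket.
Qed.

Fact T_actWA x a v :
  T_actW x (T_actA a v) = T_actA (x a) v + T_actA a (T_actW x v).
Proof.
have [f ->] := sol_ofP x; rewrite !T_actW_of /=.
elim/free_module_ind: v => [s||c u v IHu IHv]; last first.
- by rewrite !T_actA_linear !fext2_linr T_actA_linear IHu IHv scalerDr addrACA.
- by rewrite !T_simp !fext20r T_simp addr0.
elim/laurent_ind: a => [r||c a1 a2 IH1 IH2]; last first.
- rewrite solenoidal_d_is_linear mulrDr -scalerAr !T_actA_linearl.
  by rewrite fext2_linr IH1 IH2 scalerDr addrACA.
- by rewrite linear0 mulr0 !T_simp fext20r addr0.
elim/laurent_ind: f => [q||c f1 f2 IH1 IH2]; last first.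
- rewrite mulrDl -scalerAl !fext2_linl T_actA_linearl T_actA_linear.
  by rewrite IH1 IH2 scalerDr addrACA.
- by rewrite mul0r !fext20l !T_simp addr0.
have TwE p t : Tw (monom K p) (fbasis K t) = T_act_e p t by apply: fext2U.
have TaZ a c u : T_actA a (c *: u) = c *: T_actA a u.
  by rewrite -[c *: u]addr0 T_actA_linear T_simp addr0.
have TaZl a c u : T_actA (c *: a) u = c *: T_actA a u.
  by rewrite -[c *: a]addr0 T_actA_linearl T_simp addr0.
rewrite -/(tbasis s) solenoidal_dE -scalerAr -monomD TaZl !T_actA_monom.
rewrite /tbasis !TwE /T_act_e TaZ !T_actA_monom -!tshiftD (addrC r q).
rewrite -scalerDl; congr (_ *: _) => /=.
by ring.
Qed.

(* T(alpha, beta), whose actions on the basis v_s = [tbasis s] are given by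
   [T_actA_monom] and [T_actW_e]. *)
Definition tensor_module : AWmodule mu :=
  AWModule T_actA_linear T_actA_linearl T_actA1 T_actAM
    T_actW_linear T_actW_linearl T_actW_bracket T_actWA.

End TensorFields.

(* Main.v *)
(* Multiplication by t^r identifies the weight spaces of a simple cuspidal
   module M with one fiber U = M_beta, so M = A (x) U as an A-module, and
   P_r = t^{-r} e_r is an irreducible representation on U of the Lie algebra
   m d_mu, where m is the augmentation ideal of A and P_r - P_0 is the image of
   (t^r - 1) d_mu.  Linear dependence in End U of the images of the powers of
   t^k - 1, together with a trick with double brackets ([kernel_mul]), produces
   for every k a power of t^k - 1 in the ideal a = {f | f A d_mu acts by 0}, so
   A / a is local.  If Q = {f in m | f' in m} were not contained in a, the elements of Q
   killed by m modulo a would act by a nonzero abelian ideal of traceless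
   operators, which is impossible on an irreducible module.  Hence Q acts by 0,
   P_r = P_0 + (mu . r) X with P_0 and X central, and dim U = 1. *)
From HB Require Import structures.
Require Import Defs.
From mathcomp Require Import all_boot all_order all_algebra.
From mathcomp Require Import reals complex.
From mathcomp Require Import ring.

Set Implicit Arguments.
Unset Strict Implicit.
Unset Printing Implicit Defensive.

Import GRing.Theory Num.Theory.
Local Open Scope ring_scope.

(** * Irreducible sets of operators and commuting nilpotent families *)

Definition subspace (K : fieldType) (V : lmodType K) (S : V -> Prop) :=
  S 0 /\ forall c u v, S u -> S v -> S (c *: u + v).

Section Irreducible.
Variables (K : fieldType) (m : nat).
Implicit Types (L F : 'M[K]_m -> Prop) (X Z : 'M[K]_m) (v : 'rV[K]_m).

(* Operators act on row vectors, by multiplication on the right. *)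
Definition irreducible L := forall S : 'rV[K]_m -> Prop,
  subspace S -> (forall X v, L X -> S v -> S (v *m X)) ->
  forall v, v != 0 -> S v -> forall u, S u.

(** Take a nonzero [F]-stable row space [V] of least rank. Each [Z] in [F] has a kernel vector in
    [V], so [V *m Z] has smaller rank; it is again [F]-stable by commutativity, hence zero. *)
Lemma nilpotent_common_kernel F : (0 < m)%N ->
    (forall X Z, F X -> F Z -> X *m Z = Z *m X) ->
    (forall Z, F Z -> forall v, exists p, iter p (fun w => w *m Z) v = 0) ->
  exists2 v : 'rV_m, v != 0 & forall Z, F Z -> v *m Z = 0.
Proof.
move=> m_gt0 FC Fnil.
pose P r := `[< exists V : 'M[K]_m, [/\ V != 0, \rank V = r &
  forall Z, F Z -> (V *m Z <= V)%MS] >].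
have exP : exists r, P r.
  exists m; apply/asboolP; exists 1%:M; split; last by move=> *; apply: submx1.
    by rewrite -mxrank_eq0 mxrank1 -lt0n.
  exact: mxrank1.
have [r /asboolP[V [V0 rV VF]] minr] := ex_minnP exP.
have [v vV v0] : exists2 v : 'rV_m, (v <= V)%MS & v != 0.
  by move/rowV0Pn: V0 => [v vV v0]; exists v.
exists v => // Z FZ; suff VZ0 : V *m Z = 0.
  by have /submxP[D ->] := vV; rewrite -mulmxA VZ0 mulmx0.
have [w [wV w0 wZ]] : exists w : 'rV_m, [/\ (w <= V)%MS, w != 0 & w *m Z = 0].
  have [p] := Fnil Z FZ v.
  elim: p v vV v0 => [|p IHp] u uV u0; first by move/eqP; rewrite (negPf u0).
  rewrite iterSr => up.
  have [uZ|uZ] := eqVneq (u *m Z) 0; first by exists u.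
  by apply: IHp up => //; apply: submx_trans (VF _ FZ); apply: submxMr.
apply/eqP/negPn/negP => VZ0.
have /minr : P (\rank (V *m Z)).
  apply/asboolP; exists (V *m Z); split=> // Y FY.
  by rewrite -mulmxA (FC _ _ FZ FY) mulmxA submxMr ?VF.
(* By rank-nullity, minimality makes [V] meet the kernel of [Z] trivially, against [w]. *)
rewrite -rV -(mxrank_mul_ker V Z) -{2}[\rank (V *m Z)]addn0 leq_add2l leqn0.
rewrite mxrank_eq0 -submx0 => /(submx_trans _)-/(_ _ w).
rewrite sub_capmx wV; have -> : (w <= kermx Z)%MS by apply/sub_kermxP.
by move=> /(_ isT); rewrite submx0 (negPf w0).
Qed.

End Irreducible.

(** * Eigenvalues over an algebraically closed field *)

Section ClosedIrreducible.
Variables (K : closedFieldType) (m : nat).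
Implicit Types (L F : 'M[K]_m.+1 -> Prop) (X Z : 'M[K]_m.+1).
Implicit Types (v : 'rV[K]_m.+1).

Lemma char_poly_roots Z : exists s : seq K,
  size s = m.+1 /\ char_poly Z = \prod_(z <- s) ('X - z%:P).
Proof.
have [s defp] := closed_field_poly_normal (char_poly Z).
have /monicP p1 := char_poly_monic Z; rewrite p1 scale1r in defp.
exists s; split=> //; have := size_char_poly Z.
by rewrite defp size_prod_XsubC => -[].
Qed.

Lemma mxtrace_single_eigenvalue Z c :
  (forall a, eigenvalue Z a -> a = c) -> \tr Z = c *+ m.+1.
Proof.
move=> eigZ; have [s [sz defp]] := char_poly_roots Z.
have cE z : z \in s -> z = c.
  by move=> zs; apply: eigZ; rewrite eigenvalue_root_char defp root_prod_XsubC.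
have := char_poly_trace Z isT; rewrite defp -[m.+1 in LHS]sz.
rewrite coefPn_prod_XsubC ?sz // => /oppr_inj <-.
rewrite big_seq (eq_bigr (fun=> c)) => [|z /cE //].
by rewrite -big_seq big_const_seq count_predT sz iter_addr_0.
Qed.

Lemma exists_eigenvalue Z : exists c, eigenvalue Z c.
Proof.
have [[|c s] [// _ defp]] := char_poly_roots Z; exists c.
by rewrite eigenvalue_root_char defp root_prod_XsubC mem_head.
Qed.

(** Schur's lemma: an eigenspace of [Z] is stable under [L], hence everything. *)
Lemma central_scalar L Z : irreducible L ->
  (forall X, L X -> X *m Z = Z *m X) -> exists c, Z = c%:M.
Proof.
move=> irrL ZC; have [c /eigenvalueP[v vZ v0]] := exists_eigenvalue Z.
exists c; pose S (u : 'rV_m.+1) := u *m Z = c *: u.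
suff SE u : S u.
  by apply/row_matrixP => i; rewrite !rowE SE mul_mx_scalar.
apply: (irrL S _ _ v) => //; rewrite /S.
  split; first by rewrite mul0mx scaler0.
  by move=> a w1 w2 e1 e2; rewrite mulmxDl -scalemxAl e1 e2 scalerDr !scalerA
    mulrC.
by move=> X w LX wZ; rewrite -mulmxA (ZC X LX) mulmxA wZ scalemxAl.
Qed.

(* Since [[X, Z], Z] = 0, the operators of L preserve the generalized
   eigenspaces of Z. *)
Lemma single_generalized_eigenvalue L Z : irreducible L ->
    (forall X, L X -> Z *m (Z *m X - X *m Z) = (Z *m X - X *m Z) *m Z) ->
  exists c, forall v, exists p, iter p (fun w => w *m (Z - c%:M)) v = 0.
Proof.
move=> irrL ZZX; have [c /eigenvalueP[v vZ v0]] := exists_eigenvalue Z.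
exists c; pose T := Z - c%:M.
pose S (u : 'rV_m.+1) := exists p, iter p (fun w => w *m T) u = 0.
have iter0 p q (u : 'rV_m.+1) : iter p (fun w => w *m T) u = 0 ->
   (p <= q)%N -> iter q (fun w => w *m T) u = 0.
  move=> up /subnK <-; rewrite iterD up.
  by elim: (q - p)%N => //= k ->; rewrite mul0mx.
have iterL p a (u w : 'rV_m.+1) : iter p (fun w => w *m T) (a *: u + w) =
    a *: iter p (fun w => w *m T) u + iter p (fun w => w *m T) w.
  by elim: p => //= p ->; rewrite mulmxDl scalemxAl.
apply: (irrL S _ _ v) => //.
- split; first by exists 0%N.
  move=> a u w [p up] [q wq]; exists (p + q)%N.
  rewrite iterL (iter0 _ _ _ up) ?leq_addr // (iter0 _ _ _ wq) ?leq_addl //.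
  by rewrite scaler0 addr0.
- move=> X u LX [p up]; exists p.+1.
  pose B := Z *m X - X *m Z.
  have TB : T *m B = B *m T.
    have ZB : Z *m B = B *m Z by apply: ZZX.
    rewrite /T (mulmxBl Z) (mulmxBr B) ZB.
    by rewrite mul_scalar_mx mul_mx_scalar.
  have XT : X *m T = T *m X - B.
    rewrite /T /B mulmxBl mulmxBr mul_scalar_mx mul_mx_scalar opprB.
    by rewrite [RHS]addrC addrA subrK.
  have iterB q (w : 'rV_m.+1) :
      iter q (fun w => w *m T) (w *m B) = iter q (fun w => w *m T) w *m B.
    by elim: q => //= q ->; rewrite -!mulmxA TB.
  (* As [B] commutes with [T], iterating [XT] gives X T^(q+1) = T^(q+1) X - (q+1) T^q B, so [X]
     raises the nilpotency exponent of a vector by at most one. *)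
  have iterX q : forall w : 'rV_m.+1, iter q.+1 (fun w => w *m T) (w *m X) =
      iter q.+1 (fun w => w *m T) w *m X - iter q (fun w => w *m T) w *m B *+
        q.+1.
    elim: q => [|q IHq] w; first by rewrite /= -(mulmxA w X) XT mulmxBr !mulmxA.
    rewrite iterS IHq [in RHS]iterS mulmxBl.
    have -> : (iter q (fun w => w *m T) w *m B *+ q.+1) *m T =
              (iter q.+1 (fun w => w *m T) w *m B) *+ q.+1.
      by rewrite -scaler_nat -scalemxAl scaler_nat -mulmxA -TB mulmxA.
    by rewrite -(mulmxA _ X) XT mulmxBr !mulmxA -addrA -opprD -mulrS.
  by rewrite iterX up /= up !mul0mx mul0rn subr0.
- exists 1%N; rewrite /= mulmxBr vZ mul_mx_scalar subrr //.
Qed.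

End ClosedIrreducible.

(** * Abelian ideals of traceless operators *)

Section AbelianIdeal.
Variables (K : numClosedFieldType) (m : nat) (L F : 'M[K]_m.+1 -> Prop).
Hypothesis irrL : irreducible L.
Hypothesis FC : forall X Z, F X -> F Z -> X *m Z = Z *m X.
Hypothesis adF : forall X Z, L X -> F Z -> F (Z *m X - X *m Z).
Hypothesis trF : forall Z, F Z -> \tr Z = 0.

(** Each member has a single generalized eigenvalue, which is zero by the trace condition in
    characteristic zero, so [F] consists of commuting nilpotents. Their common kernel is nonzero,
    and stable under [L] because [F] absorbs brackets; by irreducibility it is everything. *)
Lemma traceless_abelian_ideal Z : F Z -> Z = 0.
Proof.
have nilF Y : F Y -> forall v : 'rV_m.+1, exists p,
  iter p (fun w => w *m Y) v = 0.
  move=> FY.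
  have [X LX|c Yc] := single_generalized_eigenvalue (Z := Y) irrL.
    exact/FC/adF.
  suff c0 : c = 0 by move=> v; have [p] := Yc v; rewrite c0 raddf0 subr0;
    exists p.
  have := trF FY; rewrite (mxtrace_single_eigenvalue (c := c)).
    by move/eqP; rewrite mulrn_eq0 => /eqP.
  move=> a /eigenvalueP[v vY v0]; have [p] := Yc v.
  (* On an eigenvector for [a] the iterates multiply by powers of [a - c], so nilpotency forces
     [a = c]. *)
  have -> : iter p (fun w => w *m (Y - c%:M)) v = (a - c) ^+ p *: v.
    elim: p => [|p IHp]; first by rewrite expr0 scale1r.
    rewrite iterS IHp -scalemxAl mulmxBr vY mul_mx_scalar -scalerBl scalerA.
    by rewrite exprSr.
  by move/eqP; rewrite scaler_eq0 (negPf v0) orbF expf_eq0 subr_eq0 => /andP[_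
    /eqP].
have [v v0 vF] := nilpotent_common_kernel (ltn0Sn m) FC nilF.
move=> FZ; pose S (u : 'rV[K]_m.+1) := forall Y, F Y -> u *m Y = 0.
suff SE u : S u by apply/row_matrixP => i; rewrite row0 rowE SE.
apply: (irrL (S := S) _ _ v0 vF).
  split=> [Y _|a u1 u2 S1 S2 Y FY]; first by rewrite mul0mx.
  by rewrite mulmxDl -scalemxAl S1 // S2 // scaler0 addr0.
move=> X w LX Sw Y FY; have := Sw _ (adF LX FY).
by rewrite mulmxBr !mulmxA Sw // mul0mx sub0r => /eqP; rewrite oppr_eq0 => /eqP.
Qed.

End AbelianIdeal.

(** * Augmentation and bracket on the Laurent ring *)

Section LaurentExtra.
Variables (K : fieldType) (n : nat) (mu : 'rV[K]_n).
Local Notation A := (laurent K n).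
Local Notation d := (solenoidal_d mu).
Implicit Types (f g h : A) (r s : 'rV[int]_n).

(** Evaluation at the point t = (1, ..., 1), with kernel m. The type [K^o] is the field viewed as a
    module over itself. *)
Definition augmentation : A -> K := fext (fun=> 1 : K^o).
Local Notation eps := augmentation.

HB.instance Definition _ :=
  GRing.isLinear.Build K A K *%R eps (@fext_linr _ _ K^o (fun=> 1)).

Lemma augmentationU r : eps (monom K r) = 1.
Proof. exact: (@fextU _ _ K^o (fun=> 1)). Qed.

Lemma augmentationM f g : eps (f * g) = eps f * eps g.
Proof.
elim/laurent_ind: f => [r||c f1 f2 IH1 IH2].
- elim/laurent_ind: g => [s||c g1 g2 IH1 IH2].
  + by rewrite -monomD !augmentationU mulr1.
  + by rewrite mulr0 !linear0 mulr0.
  + by rewrite mulrDr -scalerAr !linearP /= IH1 IH2 mulrDr mulrCA.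
- by rewrite mul0r !linear0 mul0r.
- by rewrite mulrDl -scalerAl !linearP /= IH1 IH2 mulrDl mulrA.
Qed.

Lemma monomK r : monom K r * monom K (- r) = 1.
Proof. by rewrite -monomD subrr. Qed.

Lemma pairingN r : pairing mu (- r) = - pairing mu r.
Proof.
by apply/eqP; rewrite -addr_eq0 -pairingD addNr pairing0.
Qed.

(* The bracket of W_mu: [f d_mu, g d_mu] = (lbracket f g) d_mu. *)
Definition lbracket f g := f * d g - g * d f.

Lemma lbracket_linl g : linear (lbracket^~ g).
Proof.
move=> c f1 f2; rewrite /lbracket linearP mulrDl mulrDr -scalerAl -scalerAr.
by rewrite scalerBr opprD addrACA.
Qed.

Lemma lbracketN f g : lbracket f g = - lbracket g f.
Proof. by rewrite opprB. Qed.

End LaurentExtra.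

(** * Irreducible representations on a fiber *)

Section FiberRepresentation.
Variables (K : numClosedFieldType) (n : nat) (mu : 'rV[K]_n).
Hypotheses (n_gt0 : (0 < n)%N) (mu_generic : generic mu).
Variables (m : nat) (P : 'rV[int]_n -> 'M[K]_m.+1).
Local Notation A := (laurent K n).
Local Notation d := (solenoidal_d mu).
Local Notation eps := (@augmentation K n).
Local Notation "'t^ r" := (monom K r) (at level 8, r at level 8).
Implicit Types (f g h : A) (r s k : 'rV[int]_n).

(** The commutator of t^(-r) e_r and t^(-s) e_s. Matrices act on rows from the right, so
    [P s *m P r] applies [P s] first. *)
Hypothesis P_rel : forall r s, P s *m P r - P r *m P s =
  (pairing mu s - pairing mu r) *: P (r + s) - pairing mu s *: P s
  + pairing mu r *: P r.
Hypothesis irrP : irreducible (fun X => exists r, X = P r).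

Definition ext_rep : A -> 'M[K]_m.+1 := fext P.
Local Notation Pt := ext_rep.
HB.instance Definition _ :=
  GRing.isLinear.Build K A 'M[K]_m.+1 *:%R ext_rep (fext_linr P).

Lemma ext_repU r : Pt 't^r = P r. Proof. exact: fextU. Qed.

Lemma ext_repB f g : Pt (f - g) = Pt f - Pt g. Proof. exact: raddfB. Qed.
Lemma ext_repZ c f : Pt (c *: f) = c *: Pt f. Proof. exact: linearZ_LR. Qed.

(** Both sides are bilinear, and on monomials this is [P_rel]. On m the correction terms vanish:
    there [Pt] represents the Lie algebra m d_mu. *)
Lemma ext_rep_rel f g : Pt g *m Pt f - Pt f *m Pt g =
  Pt (lbracket mu f g) - eps f *: Pt (d g) + eps g *: Pt (d f).
Proof.
have PtP c u v : Pt (c *: u + v) = c *: Pt u + Pt v by rewrite linearP.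
have epsP c u v : eps (c *: u + v) = c * eps u + eps v by rewrite linearP.
have dP c u v : d (c *: u + v) = c *: d u + d v by rewrite linearP.
have aux c (u1 u2 v1 v2 w1 w2 : 'M[K]_m.+1) :
    c *: u1 + u2 - (c *: v1 + v2) + (c *: w1 + w2) =
    c *: (u1 - v1 + w1) + (u2 - v2 + w2).
  by apply/matrixP => i j; rewrite !mxE; ring.
elim/laurent_ind: f => [r||c f1 f2 IH1 IH2]; last first.
- rewrite lbracket_linl dP epsP !PtP mulmxDr mulmxDl -scalemxAr -scalemxAl.
  rewrite opprD addrACA -scalerBr IH1 IH2 scalerDl (scalerDr (eps g)).
  by rewrite -aux !scalerA (mulrC (eps g)).
- by rewrite /lbracket
    !(linear0, mul0r, mulr0, subr0, mulmx0, mul0mx, scale0r, scaler0, addr0).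
elim/laurent_ind: g => [s||c g1 g2 IH1 IH2]; last first.
- rewrite lbracketN lbracket_linl opprD -scalerN -!lbracketN dP epsP !PtP.
  rewrite mulmxDr mulmxDl -scalemxAr -scalemxAl.
  rewrite opprD addrACA -scalerBr IH1 IH2 scalerDl (scalerDr (eps _)).
  by rewrite -aux !scalerA (mulrC (eps _) c).
- by rewrite /lbracket
    !(linear0, mul0r, mulr0, subr0, mulmx0, mul0mx, scale0r, scaler0, addr0).
rewrite !ext_repU P_rel /lbracket !solenoidal_dE !augmentationU !scale1r.
by rewrite -!scalerAr -!monomD (addrC s r) -scalerBl !linearZ /= !ext_repU.
Qed.

Lemma solenoidal_dB f g : d (f - g) = d f - d g. Proof. exact: linearB. Qed.
Lemma solenoidal_dD f g : d (f + g) = d f + d g. Proof. exact: linearD. Qed.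
Lemma solenoidal_dN f : d (- f) = - d f. Proof. exact: linearN. Qed.
Lemma solenoidal_dZ c f : d (c *: f) = c *: d f. Proof. exact: linearZ_LR. Qed.
Lemma solenoidal_d1 : d 1 = 0.
Proof. by rewrite solenoidal_dE pairing0 scale0r. Qed.
Definition solenoidal_d_simp :=
  (solenoidal_dB, solenoidal_dD, solenoidal_dN, solenoidal_dM,
   solenoidal_d1, solenoidal_dE).

(** The kernel of the representation of m d_mu. The largest ideal of A inside it is [annih], the
    ideal a. *)
Definition isotropy_kernel f := eps f = 0 /\ Pt f = 0.
Local Notation inI := isotropy_kernel.
Definition annih f := forall h, inI (f * h).

Lemma kernel_lin c f g : inI f -> inI g -> inI (c *: f + g).
Proof.
by case=> ef Pf [eg Pg]; split; rewrite linearP /= ?ef ?eg ?Pf ?Pg ?scaler0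
  ?mulr0 addr0.
Qed.

Lemma kernel0 : inI 0. Proof. by split; rewrite linear0. Qed.

Lemma kernelD f g : inI f -> inI g -> inI (f + g).
Proof. by rewrite -{2}[f]scale1r; apply: kernel_lin. Qed.

Lemma kernelZ c f : inI f -> inI (c *: f).
Proof. by move=> If; rewrite -[_ *: _]addr0; apply: kernel_lin kernel0. Qed.

Lemma kernelB f g : inI f -> inI g -> inI (f - g).
Proof. by move=> If Ig; rewrite -scaleN1r; apply/kernelD/kernelZ. Qed.

Lemma kernel_bracket f g : inI f -> eps g = 0 -> inI (lbracket mu f g).
Proof.
move=> [ef Pf] eg; split; first by rewrite raddfB /= !augmentationM ef eg
  !mul0r subr0.
have := ext_rep_rel f g.
by rewrite Pf mulmx0 mul0mx subr0 ef eg !scale0r subr0 addr0.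
Qed.

(* [4 f b' (a c' - c a')] is the difference of the values of the symmetrized
   double bracket [{{f, g}, h} + {{f, h}, g}] at (ab, c) and at (a, bc). *)
Lemma kernel_mul f a b c : inI f -> eps a = 0 -> eps c = 0 ->
  inI (f * (d b * lbracket mu a c)).
Proof.
move=> If ea ec; pose E g h := lbracket mu (lbracket mu f g) h + lbracket mu
  (lbracket mu f h) g.
have IE g h : eps g = 0 -> eps h = 0 -> inI (E g h).
  by move=> eg eh; apply: kernelD; do 2![apply: kernel_bracket => //].
have -> : f * (d b * lbracket mu a c) = 4^-1 *: (E (a * b) c - E a (b * c)).
  have -> : E (a * b) c - E a (b * c) = 4 * (f * (d b * lbracket mu a c)).
    by rewrite /E /lbracket !solenoidal_d_simp; ring.
  have -> : (4 : A) = (4 : K)%:A by rewrite scaler_nat.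
  by rewrite mulr_algl scalerA mulVf ?scale1r // pnatr_eq0.
by apply/kernelZ/kernelB; apply: IE; rewrite ?augmentationM ?ea ?ec ?mul0r
  ?mulr0.
Qed.

(** With suitable factors, [kernel_mul] yields every monomial multiple of [f * ('t^k - 1) ^+ 2] up
    to a nonzero scalar. *)
Lemma kernel_annih f k : pairing mu k != 0 -> inI f ->
  annih (f * ('t^k - 1) ^+ 2).
Proof.
move=> k0 If h; elim/laurent_ind: h => [s||c h1 h2 I1 I2].
(* The scalar will contain mu . r for r = s - 2q - k: q = 0 works unless mu . s = mu . k, and then q
   = k gives -2 (mu . k). *)
- have [q q0] : exists q, pairing mu (s - (q + q) - k) != 0.
    case: (eqVneq (pairing mu (s - k)) 0) => e; last by exists 0;
      rewrite addr0 subr0.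
    exists k; rewrite addrAC pairingD e add0r pairingN pairingD oppr_eq0.
    by rewrite -mulr2n mulrn_eq0 (negPf k0).
  set r := s - _ - k in q0.
  have ey : eps ('t^k - 1) = 0 by rewrite raddfB /= !augmentationU subrr.
  have ey2 : eps ('t^k * 't^k - 1) = 0.
    by rewrite raddfB /= augmentationM !augmentationU mulr1 subrr.
  (* For a = t^q (t^k - 1) and c = t^q (t^(2k) - 1) one has a c' - c a' = (mu . k) t^(2q+k) (t^k -
     1)^2. *)
  have := @kernel_mul f ('t^q * ('t^k - 1)) 't^r ('t^q * ('t^k * 't^k - 1)) If.
  rewrite !augmentationM ey ey2 mulr0 => /(_ erefl erefl)/(kernelZ (pairing mu
    r * pairing mu k)^-1).
  congr inI; have -> : 't^s = 't^r * ('t^q * 't^q) * 't^k.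
    by rewrite -!monomD /r addrAC subrK subrK.
  have dA u : d 't^u = (pairing mu u)%:A * 't^u by rewrite solenoidal_dE
    mulr_algl.
  rewrite /lbracket !(solenoidal_dB, solenoidal_dD, solenoidal_dN,
    solenoidal_dM, solenoidal_d1, dA).
  transitivity ((pairing mu r * pairing mu k)^-1 *: ((pairing mu r)%:A *
    (pairing mu k)%:A
    * (f * ('t^k - 1) ^+ 2 * ('t^r * ('t^q * 't^q) * 't^k)))).
    by congr (_ *: _); ring.
  rewrite -mulrA mulr_algl mulr_algl !scalerA mulVf ?scale1r //.
  by rewrite mulf_neq0.
- by rewrite mulr0; apply: kernel0.
- by rewrite mulrDr -scalerAr; apply: kernel_lin.
Qed.

Lemma annih_kernel f : annih f -> inI f.
Proof. by move=> /(_ 1); rewrite mulr1. Qed.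

Lemma annih_mul f h : annih f -> annih (f * h).
Proof. by move=> Af g; rewrite -mulrA. Qed.

Lemma annih_lin c f g : annih f -> annih g -> annih (c *: f + g).
Proof. by move=> Af Ag h; rewrite mulrDl -scalerAl; apply: kernel_lin. Qed.

Lemma annih0 : annih 0. Proof. by move=> h; rewrite mul0r; apply: kernel0. Qed.

Lemma annihD f g : annih f -> annih g -> annih (f + g).
Proof. by rewrite -{2}[f]scale1r; apply: annih_lin. Qed.

Lemma annihZ c f : annih f -> annih (c *: f).
Proof. by move=> If; rewrite -[_ *: _]addr0; apply: annih_lin annih0. Qed.

Lemma annihB f g : annih f -> annih g -> annih (f - g).
Proof. by move=> If Ig; rewrite -scaleN1r; apply/annihD/annihZ. Qed.

(** One has g f' h = f (h g' - g h') - {f h, g}, and the bracket is in the kernel by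
    [kernel_bracket]. *)
Lemma annih_deriv f g : annih f -> eps g = 0 -> annih (g * d f).
Proof.
move=> Af eg h.
have -> : g * d f * h = f * (h * d g - g * d h) - lbracket mu (f * h) g.
  by rewrite /lbracket solenoidal_dM; ring.
by apply: kernelB => //; apply: kernel_bracket.
Qed.

(** * Powers of t^k - 1 in the annihilator *)

Section Powers.
Variable k : 'rV[int]_n.
Hypothesis k0 : pairing mu k != 0.
Local Notation y := ('t^k - 1).
Local Notation H := (horner_alg y).

Lemma deriv_horner q : d (H q) = pairing mu k *: ('t^k * H q^`()).
Proof.
elim/poly_ind: q => [|p c IHp]; first by rewrite deriv0 !rmorph0 mulr0 scaler0
  linear0.
rewrite derivD derivM derivX derivC addr0 mulr1 !rmorphD !rmorphM /=.
rewrite horner_algX horner_algC solenoidal_dD linearZ /= solenoidal_d1 scaler0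
  addr0 solenoidal_dM IHp.
rewrite !solenoidal_d_simp subr0 (mulrDr 't^k) scalerDr; congr (_ + _).
  by rewrite -scalerAl mulrA.
by rewrite -scalerAr mulrC.
Qed.

(** The derivation t^(-k) (t^k - 1) d_mu / (mu . k) preserves a and acts on polynomials in t^k - 1
    as X d/dX. *)
Lemma annih_euler q : annih (H q) -> annih (H ('X * q^`())).
Proof.
move=> Aq; have ey : eps y = 0 by rewrite raddfB /= !augmentationU subrr.
have := annihZ (pairing mu k)^-1 (annih_mul 't^(- k) (annih_deriv Aq ey)).
congr annih; rewrite deriv_horner -scalerAr -scalerAl scalerA mulVf // scale1r.
rewrite rmorphM /= horner_algX.
transitivity ('t^k * 't^(-k) * (y * H q^`())); first by ring.
by rewrite monomK mul1r.
Qed.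

(** A linear dependence among (m+1)^2 + 1 matrices gives an element of the kernel; a factor
    ['X ^+ 2] moves it into a by [kernel_annih]. *)
Lemma annih_poly : exists2 q, q != 0 & annih (H q).
Proof.
(* Exponents start at one, so that the combination has augmentation zero. *)
pose B := \matrix_(i < (m.+1 * m.+1).+1) mxvec (Pt (y ^+ i.+1)).
have [u uB u0] : exists2 u : 'rV_((m.+1 * m.+1).+1), u *m B = 0 & u != 0.
  have : kermx B != 0.
    by rewrite -mxrank_eq0 mxrank_ker -lt0n subn_gt0 ltnS rank_leq_col.
  by move/rowV0Pn => [u /sub_kermxP uB u0]; exists u.
pose q := \poly_(i < (m.+1 * m.+1).+1) u 0 (inord i).
have Hq : H ('X * q) = \sum_i u 0 i *: y ^+ i.+1.
  rewrite rmorphM /= horner_algX /q poly_def linear_sum mulr_sumr.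
  apply: eq_bigr => i _; rewrite inord_val linearZ /= rmorphXn /= horner_algX.
  by rewrite mulr_algl -scalerAr exprS.
have ey : eps y = 0 by rewrite raddfB /= !augmentationU subrr.
have Iq : inI (H ('X * q)).
  rewrite Hq; split.
    rewrite linear_sum big1 // => i _; rewrite linearZ /= exprS augmentationM.
    by rewrite ey mul0r mulr0.
  apply/(can_inj mxvecK); rewrite linear0 -uB mulmx_sum_row.
  rewrite (linear_sum ext_rep) linear_sum; apply: eq_bigr => i _.
  by rewrite (linearZ_LR ext_rep) linearZ rowK.
exists ('X * q * 'X ^+ 2); last first.
  rewrite rmorphM rmorphXn /= horner_algX; exact: kernel_annih.
rewrite !mulf_neq0 ?expf_neq0 ?polyX_eq0 //.
have [i ui] : exists i, u 0 i != 0.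
  apply/existsP; apply: contraNT u0 => /existsPn u0.
  by apply/eqP/rowP => i; rewrite mxE; apply/eqP; rewrite -[_ == _]negbK u0.
apply: contraNneq ui => q0; have := coef_poly (m.+1 * m.+1).+1 (fun i => u 0
  (inord i)) i.
by rewrite -/q q0 coef0 ltn_ord inord_val => <-.
Qed.

(* X d/dX acts diagonally on the monomials, so the leading term of q can be
   isolated. *)
Lemma annih_power : exists N, annih (y ^+ N).
Proof.
have [q q0 Aq] := annih_poly; pose N := (size q).-1; exists N.
(* The product of the operators X d/dX - i over i < N kills the coefficients below N and multiplies
   that of X^N by N!. *)
suff [p Ap pE] : exists2 p, annih (H p) &
    forall j, p`_j = q`_j * \prod_(i < N) (j%:R - i%:R).
  have pN : p`_N != 0.
    rewrite pE mulf_neq0 ?lead_coef_eq0 //; apply/prodf_neq0 => i _.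
    by rewrite subr_eq0 eqr_nat gtn_eqF.
  have -> : y ^+ N = (p`_N)^-1 *: H p; last exact: annihZ.
  have -> : p = p`_N *: 'X^N.
    apply/polyP => j; rewrite coefZ coefXn pE.
    have [->|jN] := eqVneq j N; first by rewrite pE mulr1.
    rewrite mulr0; case: (ltngtP j N) jN => // jN _.
      by rewrite (bigD1 (Ordinal jN)) //= subrr mul0r mulr0.
    rewrite nth_default ?mul0r //; move: jN; rewrite /N.
    by case: (size q).
  rewrite coefZ coefXn eqxx mulr1 linearZ /= rmorphXn /= horner_algX.
  by rewrite mulr_algl scalerA mulVf ?scale1r.
elim: N => [|N [p Ap pE]].
  by exists q => // j; rewrite big_ord0 mulr1.
exists ('X * p^`() - N%:R *: p).
  by rewrite linearB linearZ /= mulr_algl; apply: annihB (annihZ _ _) => //;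
    apply: annih_euler.
move=> j; rewrite big_ord_recr /= mulrA -pE coefB coefZ coefXM coef_deriv
  mulrBr.
rewrite mulr_natr (mulrC _ N%:R); congr (_ - _).
by case: j => [|j] /=.
Qed.

End Powers.

(** For fixed [g] these exponents form a subgroup of Z^n containing the standard generators. *)
Lemma annih_monom_sub1 g :
  (forall i : 'I_n, annih (g * ('t^(delta_mx 0 i) - 1))) ->
  forall r, annih (g * ('t^r - 1)).
Proof.
move=> Ag; pose G r := annih (g * ('t^r - 1)).
have G0 : G 0 by rewrite /G (_ : 't^0 = 1) // subrr mulr0; apply: annih0.
have GD r s : G r -> G s -> G (r + s).
  move=> Gr Gs; have := annihD (annih_mul 't^s Gr) Gs; congr annih.
  by rewrite monomD; ring.
have GN r : G r -> G (- r).
  move=> /(annih_mul (- 't^(- r))); congr annih.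
  transitivity (g * ('t^(-r) - 't^r * 't^(-r))); first by ring.
  by rewrite monomK.
have GM r p : G r -> G (r *+ p).
  by move=> Gr; elim: p => [|p IHp]; rewrite ?mulr0n // mulrS; apply: GD.
move=> r; rewrite -/(G r) [r]row_sum_delta.
elim/big_ind: _ => // i _; rewrite -[r 0 i]intz scaler_int.
by case: (r 0 i) => p; [apply: GM|apply/GN/GM]; apply: Ag.
Qed.

Lemma annih_augmentation g : (forall r, annih (g * ('t^r - 1))) ->
  forall f, eps f = 0 -> annih (g * f).
Proof.
move=> Ag f ef; have -> : f = f - (eps f)%:A by rewrite ef scale0r subr0.
elim/laurent_ind: f {ef} => [r||c f1 f2 A1 A2].
- by rewrite augmentationU scale1r.
- by rewrite linear0 scale0r subr0 mulr0; apply: annih0.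
- have := annih_lin c A1 A2; congr annih.
  rewrite linearP /= scalerDl -scalerA.
  by rewrite scalerAr -mulrDr scalerBr opprD addrACA.
Qed.

(* Descend to the socle of A / annih. *)
Lemma annih_socle f : ~ annih f ->
  exists2 h, ~ annih (f * h) & forall g, eps g = 0 -> annih (f * h * g).
Proof.
move=> nf.
suff [h nh Ah] : exists2 h, ~ annih (f * h) &
    forall i : 'I_n, i \in enum 'I_n -> annih (f * h * ('t^(delta_mx 0 i) - 1)).
  exists h => //; apply: annih_augmentation; apply: annih_monom_sub1 => i.
  by apply: Ah; rewrite mem_enum.
elim: (enum 'I_n) => [|i l [h nh Ah]]; first by exists 1; rewrite ?mulr1.
set y := 't^(delta_mx 0 i) - 1.
have [N AN] : exists N, annih (y ^+ N).
  apply: annih_power; apply: mu_generic; apply/eqP => /matrixP/(_ 0 i).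
  by rewrite !mxE !eqxx.
have : annih (f * h * y ^+ N) by rewrite mulrC; apply: annih_mul.
(* Descend to the highest power of [y] that keeps [f * h] outside a; it extends [h], and the
   variables already treated stay killed. *)
elim: N {AN} => [|N IHN]; first by rewrite mulr1.
have [/IHN //|nN AN] := pselect (annih (f * h * y ^+ N)).
exists (h * y ^+ N); first by rewrite mulrA.
move=> j; rewrite in_cons => /predU1P[->|/Ah Aj].
  by rewrite -/y -!mulrA -exprSr mulrA.
by rewrite mulrA mulrAC; apply: annih_mul.
Qed.

(** The ideal Q: vanishing to second order at (1, ..., 1) in the direction d_mu. *)
Definition second_order f := eps f = 0 /\ eps (d f) = 0.

(** Commutators have trace zero, so [P_rel] becomes a functional equation for tr P_r - tr P_0,
    solved only by multiples of mu . r. Hence Q acts by traceless operators. *)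
Lemma ext_rep_trace : exists tau alpha : K, forall f,
  \tr (Pt f) = eps f * tau + alpha * eps (d f).
Proof.
pose i0 := Ordinal n_gt0; pose k0 : 'rV[int]_n := delta_mx 0 i0.
have k0n : pairing mu k0 != 0.
  by apply: mu_generic; apply/eqP => /matrixP/(_ 0 i0); rewrite !mxE !eqxx.
pose tau := \tr (P 0); pose ph r := \tr (P r) - tau.
have phE r s : (pairing mu s - pairing mu r) * ph (r + s) = pairing mu s * ph s
  - pairing mu r * ph r.
  have : \tr (P s *m P r - P r *m P s) = 0 by rewrite raddfB /= mxtrace_mulC
    subrr.
  rewrite P_rel !(raddfD, raddfN) /= !mxtraceZ /ph => e.
  by rewrite -[LHS]subr0 -e; ring.
have ph0 : ph 0 = 0 by rewrite /ph subrr.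
have phN k : pairing mu k != 0 -> ph (- k) = - ph k.
  move=> kn; have := phE (- k) k; rewrite addNr ph0 mulr0 pairingN => /esym/eqP.
  rewrite mulNr opprK -mulrDr mulf_eq0 (negPf kn) addrC addr_eq0 => /eqP ->.
  by [].
(* The sum of the equations at (k, s) and (-k, k + s) is 2 (mu . k) times the additivity
   relation. *)
have phD k s : pairing mu k != 0 -> ph (k + s) = ph k + ph s.
  move=> kn; have e1 := phE k s.
  have := phE (- k) (k + s); rewrite addKr phN // pairingN pairingD => e2.
  have k2 : 2 * pairing mu k != 0 by rewrite mulf_neq0 ?pnatr_eq0.
  apply: (mulfI k2).
  apply/eqP; rewrite -subr_eq0; apply/eqP.
  move/eqP: e1; rewrite -subr_eq0 => /eqP e1.
  move/eqP: e2; rewrite -subr_eq0 => /eqP e2.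
  by rewrite -[RHS]oppr0 -(addr0 0) -{1}e1 -e2; ring.
exists tau, (ph k0 / pairing mu k0).
have phk s : ph s = ph k0 / pairing mu k0 * pairing mu s.
  have := phE k0 s; rewrite phD // => e; apply: (mulfI k0n).
  have -> : pairing mu k0 * (ph k0 / pairing mu k0 * pairing mu s) = ph k0 *
    pairing mu s.
    by field.
  move/eqP: e; rewrite -subr_eq0 => /eqP e.
  by apply/eqP; rewrite -subr_eq0 -oppr_eq0 -e; apply/eqP; ring.
elim/laurent_ind => [r||c f1 f2 I1 I2].
- rewrite ext_repU solenoidal_dE linearZ /= !augmentationU mul1r mulr1 -phk.
  by rewrite /ph addrC subrK.
- by rewrite !linear0 mul0r mulr0 addr0.
- by rewrite !linearP /= I1 I2; ring.
Qed.

(** Within Q, the preimage of the socle of the local ring A / a. *)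
Definition socle g := second_order g /\ forall h, eps h = 0 -> annih (g * h).

Lemma socle_mul g h : socle g -> socle (g * h).
Proof.
case=> [[eg edg] Ag]; split.
  split; first by rewrite augmentationM eg mul0r.
  by rewrite solenoidal_dM linearD /= !augmentationM eg edg !mul0r addr0.
by move=> f ef; rewrite mulrAC; apply/annih_mul/Ag.
Qed.

Lemma socle_bracket f g : eps f = 0 -> socle g -> socle (lbracket mu f g).
Proof.
move=> ef [[eg edg] Ag]; split.
  split; first by rewrite /lbracket raddfB /= !augmentationM ef eg !mul0r subr0.
  rewrite /lbracket solenoidal_dB !solenoidal_dM raddfB !raddfD /=
    !augmentationM.
  by rewrite ef eg edg !(mul0r, mulr0, addr0, subr0).
move=> h eh; have -> : lbracket mu f g * h = f * d (g * h) - g * f * d h - g *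
  h * d f.
  by rewrite /lbracket !solenoidal_d_simp; ring.
by apply: annihB; [apply: annihB;
  [apply/annih_deriv/ef/Ag|apply/annih_mul/Ag]|apply/annih_mul/Ag].
Qed.

(** [traceless_abelian_ideal] applies to the image of the socle: brackets of two socle elements lie
    in a because their derivatives are in m, [socle_bracket] gives an ideal, and [ext_rep_trace]
    kills the traces. *)
Lemma ext_rep_socle g : socle g -> Pt g = 0.
Proof.
move=> Sg; pose F X := exists2 g, socle g & X = Pt g.
apply: (traceless_abelian_ideal (F := F) irrP); last by exists g.
- move=> _ _ [f [[ef edf] Af] ->] [h [[eh edh] Ah] ->]; apply/eqP.
  rewrite -subr_eq0 ext_rep_rel ef eh !scale0r subr0 addr0.
  by have [_ ->] := annih_kernel (annihB (Ah _ edf) (Af _ edh)).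
(* Replacing t^r by t^r - 1 absorbs the term [Pt (d h)] of [ext_rep_rel]. *)
- move=> _ _ [r ->] [h Sh ->]; exists (lbracket mu ('t^r - 1) h).
    by apply: socle_bracket => //; rewrite raddfB /= !augmentationU subrr.
  have [[eh _] _] := Sh; rewrite -ext_repU ext_rep_rel eh augmentationU scale1r.
  rewrite scale0r addr0 -raddfB /=; congr Pt;
    rewrite /lbracket !solenoidal_d_simp.
  by ring.
- move=> _ [h [[eh edh] _] ->]; have [tau [al ->]] := ext_rep_trace.
  by rewrite eh edh mul0r mulr0 addr0.
Qed.

(** Otherwise some multiple f h lies in the socle but not in a; yet all multiples of f h are in the
    socle and act by zero, which puts f h in a. *)
Lemma second_order_annih f : second_order f -> annih f.
Proof.
move=> [ef edf]; apply: contrapT => /annih_socle[h nA sA]; apply: nA.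
have Sfh : socle (f * h).
  split=> //; split; first by rewrite augmentationM ef mul0r.
  by rewrite solenoidal_dM raddfD /= !augmentationM ef edf !mul0r addr0.
move=> g; have Sg := socle_mul g Sfh; split; last exact: ext_rep_socle.
by have [[]] := Sg.
Qed.

Theorem irreducible_fiber :
  m = 0%N /\ exists alpha beta, forall r,
    P r = (beta + alpha * pairing mu r)%:M.
Proof.
pose i0 := Ordinal n_gt0; pose k0 : 'rV[int]_n := delta_mx 0 i0.
have k0n : pairing mu k0 != 0.
  by apply: mu_generic; apply/eqP => /matrixP/(_ 0 i0); rewrite !mxE !eqxx.
have PE r : P r = P 0 + (pairing mu r / pairing mu k0) *: (P k0 - P 0).
  (* The coefficients make the derivative at (1, ..., 1) cancel, so [f] is in Q and [P r] is affine
     in mu . r. *)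
  pose f : A := pairing mu k0 *: ('t^r - 1) - pairing mu r *: ('t^k0 - 1).
  have [_] : inI f.
    apply/annih_kernel/second_order_annih; split.
      by rewrite raddfB /= !linearZ /= !raddfB /= !augmentationU subrr !mulr0
        subr0.
    have dy u : d ('t^u - 1) = pairing mu u *: 't^u.
      by rewrite solenoidal_dB solenoidal_d1 subr0 solenoidal_dE.
    rewrite solenoidal_dB !solenoidal_dZ !dy raddfB /= !linearZ /=.
    by rewrite !augmentationU !mulr1 mulrC subrr.
  rewrite ext_repB !ext_repZ !ext_repB !ext_repU => /eqP; rewrite subr_eq0.
  move=> /eqP/(congr1 ( *:%R (pairing mu k0)^-1)).
  rewrite !scalerA mulVf // scale1r mulrC => <-.
  by rewrite addrC subrK.
have P0C X : (exists r, X = P r) -> X *m P 0 = P 0 *m X.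
  move=> [r ->]; apply/eqP; rewrite -subr_eq0 P_rel pairing0 add0r subr0
    scale0r.
  by rewrite subrr addr0.
have [b P0E] := central_scalar irrP P0C.
have [a Pk0E] : exists a, P k0 = a%:M.
  apply: (central_scalar irrP) => _ [r ->]; rewrite PE P0E.
  rewrite mulmxDl mulmxDr -scalemxAl -scalemxAr mulmxBl mulmxBr.
  by rewrite !mul_scalar_mx !mul_mx_scalar.
pose al := (a - b) / pairing mu k0.
have PrE r : P r = (b + al * pairing mu r)%:M.
  rewrite PE P0E Pk0E -raddfB /= scale_scalar_mx -raddfD /=; congr (_ + _)%:M.
  by rewrite /al; field.
split; last by exists al, b.
(* All operators are scalar, so the line of the first basis vector is stable; by irreducibility it
   contains the last one. *)
pose S (v : 'rV[K]_m.+1) := exists c, v = c *: delta_mx 0 0.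
have : S (delta_mx 0 ord_max).
  apply: (irrP (S := S) _ _ (v := delta_mx 0 0)).
  - split; first by exists 0; rewrite scale0r.
    by move=> c _ _ [x ->] [y ->]; exists (c * x + y); rewrite scalerDl scalerA.
  - move=> _ _ [r ->] [x ->]; exists ((b + al * pairing mu r) * x).
    by rewrite PrE mul_mx_scalar scalerA.
  - by apply/eqP => /matrixP/(_ 0 0); rewrite !mxE !eqxx => /eqP;
    rewrite oner_eq0.
  - by exists 1; rewrite scale1r.
case=> c /matrixP/(_ 0 ord_max); rewrite !mxE !eqxx /=.
by case: (m) => // m'; rewrite mulr0 => /eqP; rewrite oner_eq0.
Qed.

End FiberRepresentation.

(** * Weight spaces under the actions of t^r and e_r *)

Section AWTheory.
Variables (K : fieldType) (n : nat) (mu : 'rV[K]_n).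
Local Notation A := (laurent K n).
Local Notation d := (solenoidal_d mu).
Local Notation "'t^ r" := (monom K r) (at level 8, r at level 8).
Implicit Types (f g : A) (r s : 'rV[int]_n) (M N : AWmodule mu).

HB.instance Definition _ M f :=
  GRing.isLinear.Build K M M *:%R (@actA _ _ _ M f) (actA_linear f).
HB.instance Definition _ M x :=
  GRing.isLinear.Build K M M *:%R (@actW _ _ _ M x) (actW_linear x).

Lemma actA_addl M f g (v : M) : actA (f + g) v = actA f v + actA g v.
Proof. by rewrite -[f]scale1r actA_linearl !scale1r. Qed.

Lemma actA0l M (v : M) : actA 0 v = 0.
Proof. by apply: (addrI (actA 0 v)); rewrite -actA_addl !addr0. Qed.

Lemma actA_scalel M c f (v : M) : actA (c *: f) v = c *: actA f v.
Proof. by rewrite -[_ *: f]addr0 actA_linearl actA0l addr0. Qed.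

Lemma actW0l M (v : M) : actW 0 v = 0.
Proof.
apply: (addrI (actW 0 v)); rewrite addr0 -[X in X + _]scale1r -actW_linearl.
by rewrite scaler0 addr0.
Qed.

Lemma actW_scalel M c x (v : M) : actW (c *: x) v = c *: actW x v.
Proof. by rewrite -[_ *: x]addr0 actW_linearl actW0l addr0. Qed.

Lemma actA_suml M (I : Type) (s : seq I) (F : I -> A) (v : M) :
  actA (\sum_(i <- s) F i) v = \sum_(i <- s) actA (F i) v.
Proof.
by elim/big_rec2: _ => [|i x y _ <-]; [apply: actA0l|apply: actA_addl].
Qed.

Lemma actA_monomK M r (v : M) : actA 't^(- r) (actA 't^r v) = v.
Proof. by rewrite -actAM -monomD addNr actA1. Qed.

Lemma actA_monomVK M r (v : M) : actA 't^r (actA 't^(- r) v) = v.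
Proof. by rewrite -actAM -monomD subrr actA1. Qed.

Lemma actW_e_monom M r s (v : M) : actW (sol_e mu r) (actA 't^s v) =
  pairing mu s *: actA 't^(r + s) v + actA 't^s (actW (sol_e mu r) v).
Proof.
rewrite actWA; congr (_ + _).
rewrite (_ : sol_e mu r 't^s = 't^r * d 't^s) // solenoidal_dE.
by rewrite -scalerAr -monomD actA_scalel.
Qed.

Lemma weight_lin M lambda c (u v : M) : weight_space lambda u ->
  weight_space lambda v -> weight_space lambda (c *: u + v).
Proof.
rewrite /weight_space /= => eu ev.
by rewrite actW_linear eu ev scalerDr !scalerA mulrC.
Qed.

Lemma weight0 M lambda : weight_space lambda (0 : M).
Proof. by rewrite /weight_space /= linear0 scaler0. Qed.

Lemma weight_actA M lambda r (v : M) : weight_space lambda v ->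
  weight_space (lambda + pairing mu r) (actA 't^r v).
Proof.
rewrite /weight_space /= => ev.
have := actW_e_monom 0 r v; rewrite add0r => ->.
by rewrite [actW (sol_e mu 0) v]ev linearZ /= -scalerDl addrC.
Qed.

Lemma weight_actW_e M lambda r (v : M) : weight_space lambda v ->
  weight_space (lambda + pairing mu r) (actW (sol_e mu r) v).
Proof.
rewrite /weight_space /= => ev; have := actW_bracket (sol_e mu 0) (sol_e mu r)
  v.
rewrite sol_bracket_e pairing0 subr0 add0r actW_scalel [actW (sol_e mu 0) v]ev
  linearZ /=.
by move=> e; rewrite scalerDl e addrC subrK.
Qed.

Lemma pairing_inj : generic mu -> injective (pairing mu).
Proof.
move=> mu_gen r s e; apply/eqP; rewrite -subr_eq0; apply: contraTT isT.
by move/mu_gen; rewrite pairingD pairingN e subrr eqxx.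
Qed.

(** Genericity makes the weights beta + mu . r pairwise distinct, so a sum over exponents is a sum
    over weights. *)
Lemma weight_independent M (beta : K) (D : seq 'rV[int]_n) (u : 'rV[int]_n ->
  M) :
    generic mu -> weight_module M -> uniq D ->
    (forall r, weight_space (beta + pairing mu r) (u r)) ->
    \sum_(r <- D) u r = 0 ->
  forall r, r \in D -> u r = 0.
Proof.
move=> mu_gen [_ indep] uD uw u0 r rD.
have pinj s1 s2 : beta + pairing mu s1 = beta + pairing mu s2 -> s1 = s2.
  by move/addrI/(pairing_inj mu_gen).
pose w lambda := \sum_(s <- D | beta + pairing mu s == lambda) u s.
have wE s : s \in D -> w (beta + pairing mu s) = u s.
  move=> sD; rewrite /w -big_filter.
  have -> : [seq t <- D | beta + pairing mu t == beta + pairing mu s] = [:: s].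
    rewrite -(filter_pred1_uniq uD sD); apply: eq_filter => t /=.
    by apply/eqP/eqP => [/pinj|->].
  by rewrite big_seq1.
rewrite -(wE r rD); apply: (indep [seq beta + pairing mu s | s <- D]).
- by rewrite map_inj_uniq // => s1 s2 /pinj.
- move=> lambda; rewrite /w; elim/big_rec: _ => [|s v /eqP <- wv];
    first exact: weight0.
  by rewrite -[u s]scale1r; apply: weight_lin.
- by rewrite big_map big_seq (eq_bigr u) -?big_seq // => s /wE.
- exact: map_f.
Qed.

(** * Modules free of rank one over A *)

Section RankOne.
Variables (M N : AWmodule mu) (v : M) (w : N) (gamma : 'rV[int]_n -> K).
Hypothesis ev : forall r, actW (sol_e mu r) v = gamma r *: actA 't^r v.
Hypothesis ew : forall r, actW (sol_e mu r) w = gamma r *: actA 't^r w.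
Variables (vi : M -> A) (wi : N -> A).
Hypothesis vK : cancel (fun a => actA a v) vi.
Hypothesis viK : cancel vi (fun a => actA a v).
Hypothesis wK : cancel (fun a => actA a w) wi.
Hypothesis wiK : cancel wi (fun a => actA a w).

Definition transport (x : M) : N := actA (vi x) w.

Fact transport_linear : linear transport.
Proof.
move=> c x y; rewrite /transport -actA_linearl; congr (actA _ w).
by apply: (can_inj vK); rewrite actA_linearl !viK.
Qed.

HB.instance Definition _ :=
  GRing.isLinear.Build K M N *:%R transport transport_linear.

Lemma actW_cyclic (Q : AWmodule mu) (q : Q) f :
    (forall r, actW (sol_e mu r) q = gamma r *: actA 't^r q) ->
  actW (sol_of mu f) q = actA (fext (fun r => gamma r *: 't^r) f) q.
Proof.
move=> eq; elim/laurent_ind: f => [r||c f g IHf IHg].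
- by rewrite fextU actA_scalel -eq.
- have -> : sol_of mu 0 = 0.
    by apply/val_inj/funext => h; apply: mul0r.
  by rewrite linear0 actA0l actW0l.
- by rewrite sol_of_lin actW_linearl IHf IHg linearP actA_linearl.
Qed.

(** The compatibility rule determines the action of W_mu by its values on the generator, and these
    are given by the same [gamma] on both sides. *)
Lemma rank_one_iso : AWiso M N.
Proof.
exists transport; split.
- exists (fun y => actA (wi y) v) => [x|y]; first by rewrite /transport wK viK.
  by rewrite /= /transport (vK (wi y)) wiK.
- move=> a x; rewrite /transport -actAM; congr (actA _ w).
  by apply: (can_inj vK); rewrite actAM !viK.
- move=> x y; have [f ->] := sol_ofP x.
  rewrite /transport -{1}[y]viK !actWA !actW_cyclic //.
  by rewrite -!actAM -!actA_addl /=; congr (actA _ w); exact: vK.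
Qed.

End RankOne.
End AWTheory.

(** * T(alpha, beta) as a free A-module on v_beta *)

Section CyclicTensor.
Variables (K : fieldType) (n : nat) (mu : 'rV[K]_n).
Hypotheses (n_gt0 : (0 < n)%N) (mu_generic : generic mu).
Variables (alpha beta : K).
Local Notation A := (laurent K n).
Local Notation T := (tensor_module n_gt0 mu_generic alpha beta).

Fact tensor_base_subproof : beta \in tsupport mu beta.
Proof. by apply/mem_set; exists 0; rewrite ?addr0 //; exists 0;
  rewrite pairing0. Qed.

Definition tensor_base : tsupport mu beta :=
  exist (fun x => x \in tsupport mu beta) beta tensor_base_subproof.
Definition tensor_gen : T := tbasis tensor_base.

Lemma actW_tensor_gen r : actW (sol_e mu r) tensor_gen =
  (beta + alpha * pairing mu r) *: actA (monom K r) tensor_gen.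
Proof.
rewrite /= /tensor_gen T_actW_e //; congr (_ *: _).
exact/esym/T_actA_monom.
Qed.

(** By genericity, the coefficient of f v_beta at beta + mu . r is that of t^r in f. *)
Lemma tensor_gen_inj f : actA f tensor_gen = 0 -> f = 0.
Proof.
move=> /= f0; apply: fcoefP => r.
have : T_actA f tensor_gen (tshift r tensor_base) = f r.
  elim/laurent_ind: f {f0} => [s||c f g IHf IHg].
  - rewrite [T_actA _ _]T_actA_monom !fbasisE; congr (nat_of_bool _)%:R.
    apply/eqP/eqP => [|->//] /(congr1 val)/= /addrI.
    exact: pairing_inj.
  - by rewrite T_actA0l.
  - by rewrite T_actA_linearl !fcoefD !fcoefZ IHf IHg.
by rewrite f0.
Qed.

Lemma tensor_gen_surj (x : T) : exists f, actA f tensor_gen = x.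
Proof.
rewrite /=; elim/free_module_ind: x => [s||c x y [f ef] [g eg]].
- have /set_mem[_ [r ->] rs] := valP s; exists (monom K r).
  by rewrite [LHS]T_actA_monom; congr fbasis; apply: val_inj.
- by exists 0; rewrite T_actA0l.
- by exists (c *: f + g); rewrite T_actA_linearl ef eg.
Qed.

End CyclicTensor.

(** * The fiber U = M_beta and the decomposition M = A (x) U *)

Section Fiber.
Variables (K : fieldType) (n : nat) (mu : 'rV[K]_n) (M : AWmodule mu).
Hypotheses (mu_generic : generic mu) (wM : weight_module M).
Variables (beta : K) (m : nat) (b : 'I_m -> M).
Hypothesis b_weight : forall i, weight_space beta (b i).
Hypothesis b_free : forall c : 'I_m -> K, \sum_i c i *: b i = 0 -> forall i,
  c i = 0.
Hypothesis b_span : forall v : M, weight_space beta v ->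
  exists c : 'I_m -> K, v = \sum_i c i *: b i.
Local Notation A := (laurent K n).
Local Notation d := (solenoidal_d mu).
Local Notation "'t^ r" := (monom K r) (at level 8, r at level 8).
Implicit Types (f : A) (g : 'I_m -> A) (r s : 'rV[int]_n) (c : 'rV[K]_m).
Implicit Types (V : 'rV[K]_m -> Prop).

Definition fiber_vec c : M := \sum_i c 0 i *: b i.
Local Notation B := fiber_vec.

Fact fiber_vec_linear : linear fiber_vec.
Proof.
move=> a c1 c2; rewrite /B scaler_sumr -big_split; apply: eq_bigr => i _.
by rewrite !mxE scalerDl scalerA.
Qed.

HB.instance Definition _ :=
  GRing.isLinear.Build K 'rV[K]_m M *:%R fiber_vec fiber_vec_linear.

Lemma fiber_vec_eq0 c : B c = 0 -> c = 0.
Proof. by move=> B0; apply/rowP => i; rewrite mxE;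
  apply: (b_free (c := c 0)). Qed.

Lemma fiber_vec_weight c : weight_space beta (B c).
Proof.
rewrite /B; elim/big_rec: _ => [|i v _]; first exact: weight0.
exact: weight_lin.
Qed.

Lemma fiber_vec_span v : weight_space beta v -> exists c, v = B c.
Proof.
move=> /b_span[c ->]; exists (\row_i c i).
by apply: eq_bigr => i _; rewrite mxE.
Qed.

(** The operator t^(-r) e_r preserves weights, hence the fiber; [P r] is its matrix on rows. *)
Lemma fiber_matrices : exists P : 'rV[int]_n -> 'M[K]_m, forall r c,
  actW (sol_e mu r) (B c) = actA 't^r (B (c *m P r)).
Proof.
have /choice[Q QE] : forall ri : 'rV[int]_n * 'I_m,
    exists c, actW (sol_e mu ri.1) (b ri.2) = actA 't^(ri.1) (B c).
  move=> [r i] /=.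
  have := weight_actA (- r) (weight_actW_e r (b_weight i)).
  rewrite pairingN addrK => /fiber_vec_span[c cE].
  by exists c; rewrite -cE actA_monomVK.
exists (fun r => \matrix_(i, j) Q (r, i) 0 j) => r c.
rewrite mulmx_sum_row (linear_sum fiber_vec) {1}/B !linear_sum.
apply: eq_bigr => i _ /=; rewrite (linearZ_LR fiber_vec) !linearZ /=.
rewrite (QE (r, i)); congr (_ *: actA _ _).
by apply: eq_bigr => j _; rewrite !mxE.
Qed.

Section Matrices.
Variable P : 'rV[int]_n -> 'M[K]_m.
Hypothesis PE : forall r c,
  actW (sol_e mu r) (B c) = actA 't^r (B (c *m P r)).

(** Evaluate [e_r, e_s] on a fiber vector in two ways, then cancel t^(r+s) and the injective map
    [B]. *)
Lemma fiber_rel r s : P s *m P r - P r *m P s =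
  (pairing mu s - pairing mu r) *: P (r + s) - pairing mu s *: P s
  + pairing mu r *: P r.
Proof.
apply/row_matrixP => i; rewrite !rowE; set e := delta_mx 0 i.
have ee u v : actW (sol_e mu u) (actW (sol_e mu v) (B e)) =
    actA 't^(u + v) (B (pairing mu v *: (e *m P v) + e *m P v *m P u)).
  rewrite PE actW_e_monom PE -actAM -monomD (addrC v u) -linearZ -linearD /=.
  by rewrite -linearZ -linearD.
have := actW_bracket (sol_e mu r) (sol_e mu s) (B e).
rewrite sol_bracket_e actW_scalel PE !ee (addrC s r) -linearB -linearZ /=.
rewrite -linearB -linearZ /= => /(congr1 (actA 't^(- (r + s)))).
rewrite !actA_monomK => /eqP; rewrite -subr_eq0 -linearB /= =>
  /eqP/fiber_vec_eq0.
move=> /eqP; rewrite subr_eq0 => /eqP E.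
rewrite mulmxBr mulmxDr mulmxBr -!scalemxAr E !mulmxA.
by apply/rowP => j; rewrite !mxE; ring.
Qed.

(* [fiber_map] identifies A^m with M, and [fiber_sum V] is A (x) V. *)
Definition fiber_map g : M := \sum_j actA (g j) (b j).
Definition fiber_coef g r : 'rV[K]_m := \row_j g j r.
Definition fiber_sum V (v : M) :=
  exists2 g, v = fiber_map g & forall r, V (fiber_coef g r).

Lemma fiber_map_sum g : exists D : {fset 'rV[int]_n},
  (forall r, r \notin D -> fiber_coef g r = 0) /\
  fiber_map g = \sum_(r <- D) actA 't^r (B (fiber_coef g r)).
Proof.
have /choice[E EP] j : exists E : {fset 'rV[int]_n}, forall r, r \notin E ->
  g j r = 0.
  exact: fcoef_fin.
pose D := \big[@fsetU _/@fset0 _]_(j : 'I_m) E j; exists D.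
have D0 j r : r \notin D -> g j r = 0.
  move=> rD; apply: EP; apply: contra rD; apply/fsubsetP.
  exact: bigfcup_sup.
split=> [r rD|]; first by apply/rowP => j; rewrite !mxE D0.
rewrite (eq_bigr (fun r => \sum_j g j r *: actA 't^r (b j))) => [|r _];
  last first.
  by rewrite linear_sum; apply: eq_bigr => j _; rewrite linearZ mxE.
rewrite exchange_big; apply: eq_bigr => j _ /=.
rewrite -{1}[g j]fext_basis (fextw _ (D0 j)) actA_suml.
by apply: eq_bigr => r _; rewrite actA_scalel.
Qed.

Lemma fiber_map_inj g : fiber_map g = 0 -> forall j, g j = 0.
Proof.
have [D [D0 ->]] := fiber_map_sum g => s0 j; apply: fcoefP => r.
suff /rowP/(_ j) : fiber_coef g r = 0 by rewrite !mxE.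
have [rD|/D0//] := boolP (r \in D).
apply: fiber_vec_eq0; rewrite -[B _](actA_monomK r).
have ws s : weight_space (beta + pairing mu s) (actA 't^s (B (fiber_coef g s))).
  exact/weight_actA/fiber_vec_weight.
by rewrite (weight_independent mu_generic wM (fset_uniq D) ws s0) ?linear0.
Qed.

Lemma fiber_sum_subspace V : subspace V -> subspace (fiber_sum V).
Proof.
move=> [V0 VD]; split.
  exists (fun=> 0); first by rewrite /fiber_map big1 // => j _; rewrite actA0l.
  by move=> r; rewrite (_ : fiber_coef _ r = 0) //; apply/rowP => j;
    rewrite !mxE.
move=> a u v [g -> gV] [h -> hV]; exists (fun j => a *: g j + h j).
  rewrite /fiber_map scaler_sumr -big_split; apply: eq_bigr => j _.
  by rewrite actA_linearl.
move=> r; rewrite (_ : fiber_coef _ r = a *: fiber_coef g r + fiber_coef h r).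
  exact: VD.
by apply/rowP => j; rewrite !mxE.
Qed.

Lemma fiber_sum_gen V r c : subspace V -> V c -> fiber_sum V (actA 't^r (B c)).
Proof.
move=> [V0 VD] Vc; exists (fun j => c 0 j *: 't^r).
  by rewrite linear_sum; apply: eq_bigr => j _; rewrite linearZ actA_scalel.
move=> s; rewrite (_ : fiber_coef _ s = (s == r)%:R *: c + 0); first exact: VD.
by apply/rowP => j; rewrite !mxE addr0 fcoefZ fbasisE mulrC.
Qed.

Lemma subspace_sum (U : lmodType K) (S : U ->
  Prop) (I : Type) (l : seq I) (F : I -> U) :
  subspace S -> (forall i, S (F i)) -> S (\sum_(i <- l) F i).
Proof.
move=> [S0 SD] SF; elim/big_rec: _ => // i x _ Sx.
by rewrite -[F i]scale1r; apply: SD.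
Qed.

Lemma fiber_sum_stable V (X : {linear M -> M}) : subspace V ->
    (forall r c, V c -> fiber_sum V (X (actA 't^r (B c)))) ->
  forall v, fiber_sum V v -> fiber_sum V (X v).
Proof.
move=> sV XV v [g -> gV]; have [D [_ ->]] := fiber_map_sum g.
rewrite linear_sum; apply: subspace_sum; first exact: fiber_sum_subspace.
by move=> r; apply/XV/gV.
Qed.

(** Since e_r t^s = t^s e_r + (mu . s) t^(r+s), stability of V under all [P r] makes A (x) V stable
    under W_mu. *)
Lemma fiber_sum_submodule V : subspace V ->
  (forall X c, (exists r, X = P r) -> V c -> V (c *m X)) ->
    AWsubmodule (fiber_sum V).
Proof.
move=> sV VP; have [S0 SD] := fiber_sum_subspace sV.
split=> // [a v Sv|x v Sv].
- elim/laurent_ind: a => [r||a f1 f2 S1 S2]; last first.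
  + by rewrite actA_linearl; apply: SD.
  + by rewrite actA0l.
  apply: fiber_sum_stable Sv => // s c Vc /=; rewrite -actAM -monomD.
  exact: fiber_sum_gen.
- have [f ->] := sol_ofP x.
  elim/laurent_ind: f => [r||a f1 f2 S1 S2]; last first.
  + by rewrite sol_of_lin actW_linearl; apply: SD.
  + have -> : sol_of mu 0 = 0 by apply/val_inj/funext => h; apply: mul0r.
    by rewrite actW0l.
  apply: fiber_sum_stable Sv => // s c Vc /=; rewrite -/(sol_e mu r).
  rewrite actW_e_monom PE -actAM -monomD; apply: SD; apply: fiber_sum_gen => //.
  by apply: VP => //; exists r.
Qed.

Hypothesis simpleM : AWsimple M.

Lemma fiber_sum_full V c : subspace V ->
    (forall X c, (exists r, X = P r) -> V c -> V (c *m X)) -> c != 0 -> V c ->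
  forall v, fiber_sum V v.
Proof.
move=> sV VP c0 Vc v.
have [_ /(_ _ (fiber_sum_submodule sV VP))[S0|ST]] := simpleM.
  have : fiber_sum V (actA 't^0 (B c)) by apply: fiber_sum_gen.
  rewrite S0 /= actA1 => /fiber_vec_eq0 c00.
  by rewrite c00 eqxx in c0.
by rewrite ST.
Qed.

Lemma fiber_irreducible : irreducible (fun X => exists r, X = P r).
Proof.
move=> V sV VP c c0 Vc u; have [V0 _] := sV.
have [g gE gV] := fiber_sum_full sV VP c0 Vc (B u).
(* Expansions over A are unique, so [u] is the coefficient of t^0 in [g]. *)
have : fiber_map (fun j => g j - u 0 j *: 1) = 0.
  rewrite /fiber_map; under eq_bigr do rewrite actA_addl -scaleNr actA_scalel
    actA1 scaleNr.
  by rewrite big_split /= sumrN -[X in X + _]gE subrr.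
move/fiber_map_inj => gu; suff -> : u = fiber_coef g 0 by [].
apply/rowP => j; have /eqP := gu j; rewrite subr_eq0 mxE => /eqP ->.
by rewrite fcoefZ fbasisE eqxx mulr1.
Qed.

End Matrices.
End Fiber.

(** * Assembling the isomorphism from one nonzero weight space *)

Theorem corollary3p9 (R : realType) (n : nat) (mu : 'rV[R[i]]_n)
    (n_gt0 : (0 < n)%N) (mu_generic : generic mu) (M : AWmodule mu) :
  AWsimple M -> cuspidal M ->
  exists alpha beta : R[i], AWiso M (tensor_module n_gt0 mu_generic alpha beta).
Proof.
move=> simpleM [wM [N dimM]].
have [lambda [u wu u0]] : exists lambda, exists2 u : M,
  weight_space lambda u & u != 0.
  apply: contrapT => noweight; case: simpleM => nz _; apply: nz.
  apply/seteqP; split=> // v _ /=; have [wdec _] := wM.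
  have [s [u [wu ->]]] := wdec v; rewrite big1 // => l _.
  by apply: contrapT => /eqP ul0; apply: noweight; exists l; exists (u l).
have [m _ [b [bw bfree bspan]]] := dimM lambda.
have [c uE] := fiber_vec_span bspan wu.
have c0 : c != 0 by apply: contraNneq u0 => c0; rewrite uE c0 linear0.
have [P PE] := fiber_matrices bw bspan.
(* The fiber is nonzero because of [c], so its dimension is a successor, as [irreducible_fiber]
   expects. *)
case: m => [|m] in b bw bfree bspan c uE c0 P PE *.
  by rewrite (thinmx0 c) eqxx in c0.
have irrP := fiber_irreducible mu_generic wM bw bfree PE simpleM.
have [m0 [alpha [beta Pab]]] :=
  irreducible_fiber n_gt0 mu_generic (fiber_rel bfree PE) irrP.
exists alpha, beta; subst m.
have ew r : actW (sol_e mu r) (b ord0) =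
    (beta + alpha * pairing mu r) *: actA (monom _ r) (b ord0).
  have bE : b ord0 = fiber_vec b (const_mx 1).
    by rewrite /fiber_vec big_ord1 mxE scale1r.
  by rewrite {1}bE PE Pab mul_mx_scalar linearZ linearZ /= -bE.
have binj f : actA f (b ord0) = 0 -> f = 0.
  move=> f0; apply: (fiber_map_inj mu_generic wM bw bfree (g := fun=> f)) ord0.
  by rewrite /fiber_map big_ord1.
have bsurj (v : M) : exists f, actA f (b ord0) = v.
  (* Taking V to be the whole fiber shows that the fiber generates M over A. *)
  have [] := fiber_sum_full bfree PE simpleM (V := fun=> True) (c := c) _ _ _ _
    v => //.
  by move=> g -> _; exists (g ord0); rewrite /fiber_map big_ord1.
have [vi viK] := choice bsurj.
have [wi wiK] := choice (@tensor_gen_surj _ n mu n_gt0 mu_generic alpha beta).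
apply: (rank_one_iso ew (actW_tensor_gen n_gt0 mu_generic alpha beta) _ viK _
  wiK).
  move=> f; apply/eqP; rewrite -subr_eq0; apply/eqP/binj.
  by rewrite actA_addl -scaleN1r actA_scalel scaleN1r viK subrr.
move=> f; apply/eqP; rewrite -subr_eq0; apply/eqP.
apply: (@tensor_gen_inj _ n mu n_gt0 mu_generic alpha beta).
by rewrite actA_addl -scaleN1r actA_scalel scaleN1r wiK subrr.
Qed.
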